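(* For every integer $r\ge 0$ one has $v_r^{\mathrm{ch},-}\le \operatorname{vol}K\le v_r^{\mathrm{ch},+}$, and the width of this bracket satisfies $$v_r^{\mathrm{ch},+}-v_r^{\mathrm{ch},-}=\frac{2(|w|+m)}{m}\,2^n\,\varepsilon_r,\qquad \lim_{r\to\infty} r\,\bigl(v_r^{\mathrm{ch},+}-v_r^{\mathrm{ch},-}\bigr)=\frac{2^{\,n+1}(|w|+m)\sqrt{\bar g-1}}{\pi\, m}.$$ In particular, $$|V_r-\operatorname{vol}K|\le \frac{|w|+m}{m}\,2^n\,\varepsilon_r=O\!\left(\tfrac1r\right)\qquad (r\to\infty).$$
   Context: Setting: $n,m\ge1$ are integers, $w=(w_1,\dots,w_n)$ is a vector of positive integers and $|w|:=\sum_i w_i$. $g:\mathbb{R}^n\to[0,\infty)$ is a polynomial with $g(t^{w_1}x_1,\dots,t^{w_n}x_n)=t^m g(x)$ for all $t>0$, $x\in\mathbb{R}^n$ (quasi-homogeneity), and $g(x)>0$ for $x\ne0$. Let $B:=[-1,1]^n$ and $K:=\{x\in\mathbb{R}^n: g(x)\le1\}$; it is assumed that $K\subseteq B$. Let $\bar g:=\max_{x\in B}g(x)$; it is assumed that $\bar g>1$. $\operatorname{vol}$ is Lebesgue measure, and $\mu$ is the uniform probability measure on $B$, $d\mu=2^{-n}\mathbf 1_B\,dx$. Chebyshev construction: let $f(t)=(1-t)_+=\max(0,1-t)$ on $[0,\bar g]$, let $T_k$ be the Chebyshev polynomial of the first kind of degree $k$, and put $c_k:=\frac2\pi\int_{-1}^1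 f\bigl(\tfrac{\bar g}{2}(s+1)\bigr)T_k(s)(1-s^2)^{-1/2}ds$ for $k\ge0$. The degree-$r$ truncated Chebyshev approximation is $f_r^{\mathrm{ch}}(t):=\frac{c_0}{2}+\sum_{k=1}^r c_k T_k\bigl(\tfrac{2t}{\bar g}-1\bigr)$, and $\varepsilon_r:=\sup_{t\in[0,\bar g]}|f(t)-f_r^{\mathrm{ch}}(t)|$. The Chebyshev moments are $y_k^{\mathrm{ch}}:=\int_B T_k\bigl(\tfrac{2g(x)}{\bar g}-1\bigr)d\mu(x)$ (so $y_0^{\mathrm{ch}}=1$). Set $$V_r:=\frac{2^n(|w|+m)}{m}\Bigl(\frac{c_0}{2}+\sum_{k=1}^r c_k\,y_k^{\mathrm{ch}}\Bigr),\qquad v_r^{\mathrm{ch},\pm}:=V_r\pm\frac{|w|+m}{m}\,2^n\,\varepsilon_r.$$ *)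

(* Defs.v *)
From HB Require Import structures.
From mathcomp Require Import all_boot all_order all_algebra.
From mathcomp Require Import all_classical all_reals all_analysis.
(* Required but not imported: the notations of mpoly clash with those of
   MathComp-Analysis.  Its canonical structures can be activated with
   [Import(canonicals, coercions) mpoly]. *)
From mathcomp Require mpoly.

Set Implicit Arguments.
Unset Strict Implicit.
Unset Printing Implicit Defensive.

Import Order.TTheory GRing.Theory Num.Theory.
Import numFieldNormedType.Exports.

Local Open Scope classical_set_scope.
Local Open Scope ring_scope.

(* R^n with its Borel sigma-algebra; [measurableTypeR R] is [R] carrying the
   sigma-algebra on which [lebesgue_measure] is defined. *)
Notation euclid R n := (n.-tuple (measurableTypeR R)).

Section lebesgue_tuple.
Context {R : realType}.

Definition tcons n (p : measurableTypeR R * euclid R n) : euclid R n.+1 :=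
  [the n.+1.-tuple (measurableTypeR R) of p.1 :: p.2].

Lemma measurable_tcons n : measurable_fun [set: _] (@tcons n).
Proof. exact: measurable_cons. Qed.

Definition tuncons n (x : euclid R n.+1) : measurableTypeR R * euclid R n :=
  (thead x, [tuple of behead x]).

Lemma tconsK n : cancel (@tcons n) (@tuncons n).
Proof.
move=> [a x]; rewrite /tuncons /tcons /=; congr (_, _).
by apply/val_inj.
Qed.

Lemma tunconsK n : cancel (@tuncons n) (@tcons n).
Proof. by move=> x; rewrite /tcons /= [RHS]tuple_eta. Qed.

Lemma measurable_tuncons n : measurable_fun [set: _] (@tuncons n).
Proof.
apply/measurable_fun_pairP; split; first exact: measurable_tnth.
exact: measurable_behead.
Qed.

Section step.
Variables (n : nat) (mu : {sigma_finite_measure set (euclid R n) -> \bar R}).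

Definition lebesgue_tuple_step : set (euclid R n.+1) -> \bar R :=
  pushforward (lebesgue_measure \x mu)%E (@tcons n).

Let step_measure : {measure set (euclid R n.+1) -> \bar R} :=
  measure_function_pushforward__canonical__measure_function_Measure
    (lebesgue_measure \x mu)%E (@measurable_tcons n).

HB.instance Definition _ := isMeasure.Build _ _ _ lebesgue_tuple_step
  (measure0 step_measure) (measure_ge0 step_measure)
  (@measure_semi_sigma_additive _ _ _ step_measure).

Lemma lebesgue_tuple_step_sigma_finite :
  sigma_finite [set: _] lebesgue_tuple_step.
Proof.
have /sigma_finiteP[F [FT ndF Foo]] :=
  sigma_finiteT (@lebesgue_measure R : {sigma_finite_measure set _ -> \bar R}).
have /sigma_finiteP[G [GT ndG Goo]] := sigma_finiteT mu.
exists (fun k => @tuncons n @^-1` (F k `*` G k)).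
  apply/seteqP; split => // x _.
  have : [set: _] (tuncons x).1 by [].
  rewrite {1}FT => -[k _ Fk].
  have : [set: _] (tuncons x).2 by [].
  rewrite {1}GT => -[l _ Gl]; exists (maxn k l) => //; split.
    by move: Fk; exact/subsetPset/ndF/leq_maxl.
  by move: Gl; exact/subsetPset/ndG/leq_maxr.
move=> k; have [mF Fk] := Foo k; have [mG Gk] := Goo k.
have mFG := measurableX mF mG; split.
  by rewrite -[X in measurable X]setTI; exact: measurable_tuncons.
rewrite /lebesgue_tuple_step /pushforward -comp_preimage.
have -> : @tuncons n \o @tcons n = id by apply/funext => p; exact: tconsK.
by rewrite preimage_id product_measure1E// lte_mul_pinfty// ge0_fin_numE.
Qed.

HB.instance Definition _ := Measure_isSigmaFinite.Build _ _ _
  lebesgue_tuple_step lebesgue_tuple_step_sigma_finite.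

End step.

(* n-dimensional Lebesgue measure, as the n-fold product of
   [lebesgue_measure]. *)
Fixpoint lebesgue_tuple n : {sigma_finite_measure set (euclid R n) -> \bar R} :=
  match n with
  | 0 => \d_ ([tuple] : euclid R 0)
  | n'.+1 => lebesgue_tuple_step (lebesgue_tuple n')
  end.

Lemma lebesgue_tuple_prod n (A : 'I_n -> set (measurableTypeR R)) :
  (forall i, measurable (A i)) ->
  lebesgue_tuple n [set x | forall i, A i (tnth x i)] =
  (\prod_(i < n) lebesgue_measure (A i))%E.
Proof.
elim: n A => [|n IH] A mA /=.
  rewrite big_ord0 diracE mem_set//.
  by case.
rewrite /lebesgue_tuple_step /pushforward big_ord_recl.
rewrite (_ : _ @^-1` _ =
    A ord0 `*` [set x | forall i, A (lift ord0 i) (tnth x i)]); last first.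
  apply/seteqP; split => -[a x] /=.
    move=> H; split; first by have := H ord0; rewrite tnth0.
    by move=> i; have := H (lift ord0 i); rewrite tnthS.
  move=> [Aa Ax] i; case: (unliftP ord0 i) => [j ->|->].
    by rewrite tnthS.
  by rewrite tnth0.
rewrite product_measure1E//.
  by congr (_ * _)%E; exact: (IH (fun i => A (lift ord0 i))).
rewrite (_ : [set x | _] =
  \bigcap_(i in [set: 'I_n]) (@tnth _ _ ^~ i @^-1` A (lift ord0 i))); last first.
  by apply/seteqP; split => x /= H i; [move=> _; exact: H|exact: H i I].
apply: fin_bigcap_measurable => // i _.
by rewrite -[X in measurable X]setTI; exact: measurable_tnth.
Qed.

End lebesgue_tuple.

Section volume_bracket.
Context {R : realType}.

Fixpoint chebyshevT (k : nat) : {poly R} :=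
  match k with
  | 0 => 1
  | k1.+1 => match k1 with
             | 0 => 'X
             | k2.+1 => 2%:R *: ('X * chebyshevT k1) - chebyshevT k2
             end
  end.

Definition pospart1B (t : R) : R := Num.max 0 (1 - t).

(* The integrand takes the value 0 at s = -1 and s = 1, as 0^-1 = 0. *)
Definition cheb_coef (b : R) (k : nat) : R :=
  2 / pi * \int[lebesgue_measure]_(s in `[-1, 1])
    (pospart1B (b / 2 * (s + 1)) * (chebyshevT k).[s] / Num.sqrt (1 - s ^+ 2)).

Definition cheb_trunc (b : R) (r : nat) (t : R) : R :=
  cheb_coef b 0 / 2 +
  \sum_(1 <= k < r.+1) cheb_coef b k * (chebyshevT k).[2 * t / b - 1].

Definition cheb_err (b : R) (r : nat) : R :=
  sup [set `|pospart1B t - cheb_trunc b r t| | t in `[0, b]].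

Variable n : nat.

Definition peval (g : mpoly.mpoly n R) (x : euclid R n) : R :=
  mpoly.meval (fun i => tnth x i) g.

Definition quasi_homogeneous (w : 'I_n -> nat) (m : nat)
    (g : mpoly.mpoly n R) : Prop :=
  forall (t : R) (x : euclid R n), 0 < t ->
    peval g [tuple t ^+ w i * tnth x i | i < n] = t ^+ m * peval g x.

Definition cube : set (euclid R n) := [set x | forall i, -1 <= (tnth x i : R) <= 1].

Lemma measurable_cube : measurable cube.
Proof.
rewrite (_ : cube = \bigcap_(i in [set: 'I_n])
    (@tnth n (measurableTypeR R) ^~ i @^-1` `[-1, 1]%classic)).
  apply: fin_bigcap_measurable => // i _.
  by rewrite -[X in measurable X]setTI; exact: measurable_tnth.
apply/seteqP; split => x /= H i; first by move=> _; rewrite /= in_itv; exact: H.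
by have := H i I; rewrite /= in_itv.
Qed.

Definition cube_uniform : {measure set (euclid R n) -> \bar R} :=
  mscale (2%:R ^- n)%:nng (mrestr (lebesgue_tuple n) measurable_cube).

Lemma cube_uniform_setT : cube_uniform [set: _] = 1%E.
Proof.
rewrite /cube_uniform /= /mscale /= /mrestr setTI (_ : cube =
    [set x | forall i, [set` `[-1, 1]%R] (tnth x i)]); last first.
  by apply/seteqP; split => x /= H i; have := H i; rewrite /= in_itv.
rewrite (lebesgue_tuple_prod (A := fun=> [set` `[-1, 1]%R]))//.
rewrite lebesgue_measure_itv/= lte_fin gtrN// -EFinB opprK.
rewrite prodEFin prodr_const card_ord -EFinM mulVf// expf_neq0//.
Qed.

Definition sublevel1 (g : mpoly.mpoly n R) : set (euclid R n) :=
  [set x | peval g x <= 1].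

Definition cheb_moment (g : mpoly.mpoly n R) (b : R) (k : nat) : R :=
  \int[cube_uniform]_(x in cube) (chebyshevT k).[2 * peval g x / b - 1].

Definition wnorm (w : 'I_n -> nat) : nat := (\sum_(i < n) w i)%N.

Definition vol_approx (w : 'I_n -> nat) (m : nat) (g : mpoly.mpoly n R)
    (b : R) (r : nat) : R :=
  2 ^+ n * (wnorm w + m)%:R / m%:R *
  (cheb_coef b 0 / 2 + \sum_(1 <= k < r.+1) cheb_coef b k * cheb_moment g b k).

Definition vol_radius (w : 'I_n -> nat) (m : nat) (b : R) (r : nat) : R :=
  (wnorm w + m)%:R / m%:R * 2 ^+ n * cheb_err b r.

Definition vol_lower w m g b r : R :=
  vol_approx w m g b r - vol_radius w m b r.

Definition vol_upper w m g b r : R :=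
  vol_approx w m g b r + vol_radius w m b r.

End volume_bracket.

Arguments cube R n : clear implicits.

(* Main.v *)
Require Import Defs.
From mathcomp Require Import all_boot all_order all_algebra.
From mathcomp Require Import all_classical all_reals all_analysis.
From mathcomp Require Import measurable_realfun.
From mathcomp Require mpoly.
From mathcomp Require Import ring lra.

Set Implicit Arguments.
Unset Strict Implicit.
Unset Printing Implicit Defensive.

Import Order.TTheory GRing.Theory Num.Theory.
Import numFieldNormedType.Exports.

Local Open Scope classical_set_scope.
Local Open Scope ring_scope.

(* The function [f(t) = (1 - t)_+] turns the volume into a moment: by
   quasi-homogeneity [vol {g <= u} = u^(|w|/m) vol K], so Tonelli gives
   [int (1 - g)_+ = m / (|w| + m) vol K], and replacing [f] by its Chebyshev
   truncation costs at most [eps_r] on the cube, where [g] takes values in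
   [0, b], [b = gbar].

   For the rate, put [s = cos u] and [2 / b - 1 = cos t].  Up to the factor
   [b / 2], [f] becomes [u |-> (cos t - cos u)_+] and the [c_k] become explicit
   coefficients [kcoef t k].  That the cosine series converges to this function
   is shown by differentiating in the position [t] of the kink: the derivative
   of the remainder is a combination of remainders of the sawtooth series
   [sum_k sin (k x) / k], which are [O(1 / sqrt (r x))].  In the tail of the
   series the main term is
   [- (sin t / pi) sum_(k > r) cos (k (t - u)) / (k^2 - 1)], maximal in absolute
   value at [u = t], where it is equivalent to [sin t / (pi r)]; all other
   terms are [O(1 / r^2)] by Abel summation.  Finally
   [(b / 2) sin t = sqrt (b - 1)]. *)

(** * Trigonometric and mean value estimates *)

Section calculus.
Context {R : realType}.
Implicit Types (f h df dh : R -> R) (a b x y : R).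

(** Both [h - f] and [h + f] have a nonnegative derivative. Differentiability is asked only inside
    the interval, so that [h] may contain a square root whose slope is infinite at an endpoint. *)
Lemma le_norm_increment f h df dh a b : a <= b ->
  (forall x, x \in `]a, b[ -> is_derive x 1 f (df x)) ->
  (forall x, x \in `]a, b[ -> is_derive x 1 h (dh x)) ->
  {within `[a, b], continuous f} -> {within `[a, b], continuous h} ->
  (forall x, x \in `]a, b[ -> `|df x| <= dh x) ->
  `|f b - f a| <= h b - h a.
Proof.
rewrite le_eqVlt => /predU1P[<-|ab] Hf Hh cf ch le_df.
  by rewrite !subrr normr0.
have ba0 : 0 <= b - a by rewrite subr_ge0 ltW.
have [c cab Ec] := @MVT R (h \- f) (dh \- df) a b ab
  (fun x Hx => @is_deriveB _ _ _ _ _ _ _ _ _ (Hh x Hx) (Hf x Hx))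
  (fun x => @continuousB _ _ _ _ _ _ (ch x) (cf x)).
have [d dab Ed] := @MVT R (h \+ f) (dh \+ df) a b ab
  (fun x Hx => @is_deriveD _ _ _ _ _ _ _ _ _ (Hh x Hx) (Hf x Hx))
  (fun x => @continuousD _ _ _ _ _ _ (ch x) (cf x)).
have : 0 <= (dh c - df c) * (b - a).
  by rewrite mulr_ge0// subr_ge0 (le_trans (ler_norm _)) ?le_df.
have : 0 <= (dh d + df d) * (b - a).
  by rewrite mulr_ge0// -lerBlDr sub0r (le_trans (ler_norm _)) ?normrN ?le_df.
rewrite -Ec -Ed/= ler_norml; lra.
Qed.

Lemma is_derive_sum_nat (F dF : nat -> R -> R) (m n : nat) x :
  (forall k, (m <= k)%N -> is_derive x 1 (F k) (dF k x)) ->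
  is_derive x 1 (fun y => \sum_(m <= k < n) F k y) (\sum_(m <= k < n) dF k x).
Proof.
move=> HF; have [mn|nm] := leqP m n; last first.
  rewrite big_geq 1?ltnW//; under eq_fun do rewrite big_geq 1?ltnW//.
  exact: is_derive_cst.
rewrite -(subnKC mn); elim: (n - m)%N => [|d IH].
  rewrite addn0 big_geq//; under eq_fun do rewrite big_geq//.
  exact: is_derive_cst.
rewrite addnS big_nat_recr ?leq_addr//=.
under eq_fun do rewrite big_nat_recr ?leq_addr//=.
by apply: is_deriveD; apply: HF; exact: leq_addr.
Qed.

Lemma is_derive_continuous f x l : is_derive x 1 f l -> {for x, continuous f}.
Proof. by move=> Hf; apply/differentiable_continuous/derivable1_diffP. Qed.

Lemma is_derive_within_continuous f df a b :
  (forall x, x \in `[a, b] -> is_derive x 1 f (df x)) ->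
  {within `[a, b], continuous f}.
Proof.
by move=> Hf; apply: derivable_within_continuous => x /Hf H; exact: ex_derive.
Qed.

Lemma sin_natpi k : sin (k%:R * pi) = 0 :> R.
Proof.
elim: k => [|k IH]; first by rewrite mul0r sin0.
by rewrite -addn1 natrD mulrDl mul1r sinDpi IH oppr0.
Qed.

Lemma cos_nat2pi k : cos (k%:R * (pi *+ 2)) = 1 :> R.
Proof.
elim: k => [|k IH]; first by rewrite mul0r cos0.
by rewrite -addn1 natrD mulrDl mul1r cosD2pi.
Qed.

Lemma sin_nat2pi k : sin (k%:R * (pi *+ 2)) = 0 :> R.
Proof.
elim: k => [|k IH]; first by rewrite mul0r sin0.
by rewrite -addn1 natrD mulrDl mul1r sinD2pi.
Qed.

Lemma sin_sub_sin x y : sin (x + y) - sin (x - y) = 2 * sin y * cos x.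
Proof. by rewrite sinD sinB; ring. Qed.

Lemma sin_mul_cos x y : sin x * cos y = (sin (x + y) + sin (x - y)) / 2.
Proof. by rewrite sinD sinB; lra. Qed.

Lemma sin_half_gt0 x : 0 < x < pi *+ 2 -> 0 < sin (x / 2).
Proof.
move=> /andP[x0 x2]; apply: sin_gt0_pi; rewrite divr_gt0//=.
by rewrite ltr_pdivrMr// mulr_natr.
Qed.

(** With [y = x / 2] and [y * cos y <= sin y], one gets [sin x >= 2 * y * cos y ^+ 2 = y * (1 + cos
    x)], and [cos x >= 0] on this range. *)
Lemma sin_ge_half x : 0 <= x <= pi / 2 -> x / 2 <= sin x.
Proof.
move=> /andP[x0 xpi]; set y := x / 2.
have pi0 := @pi_gt0 R.
have y0 : 0 <= y by rewrite divr_ge0.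
have ypi : y <= pi / 2 by rewrite /y; lra.
have ycosy : y * cos y <= sin y.
  have Hs z : z \in `[0, y] -> is_derive z 1 (fun u : R => sin u - u * cos u) (z * sin z).
    by move=> _; apply: is_derive_eq; rewrite /GRing.scale/=; ring.
  have [c /[!in_itv]/= /andP[c0 cy]] := MVT_segment y0
    (fun z Hz => Hs z (subset_itv_oo_cc Hz)) (is_derive_within_continuous Hs).
  rewrite sin0 mul0r !subr0 -subr_ge0 => ->.
  by rewrite !mulr_ge0// sin_ge0_pi// c0/=; lra.
have cx : 0 <= cos x by apply: cos_ge0_pihalf; rewrite xpi andbT; lra.
have cy : 0 <= cos y by apply: cos_ge0_pihalf; rewrite ypi andbT; lra.
have xE : x = y *+ 2 by rewrite /y; lra.
have c2 : cos x = cos y ^+ 2 *+ 2 - 1 by rewrite xE cos_mulr2n.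
rewrite {1}xE -/y in xpi; rewrite xE sin_mulr2n.
have : y * cos y * cos y <= sin y * cos y by exact: ler_wpM2r.
have : y <= y * (2 * (cos y ^+ 2)) by rewrite ler_peMr//; lra.
rewrite expr2; lra.
Qed.

Lemma cos_bound_oo (u : R) : 0 < u < pi -> -1 < cos u < 1.
Proof.
move=> /andP[u0 u1].
have H1 : cos pi < cos u by rewrite ltr_cos// in_itv/= ?pi_ge0 ?lexx// !ltW.
have H2 : cos u < cos 0 by rewrite ltr_cos// in_itv/= ?pi_ge0 ?lexx// !ltW.
by rewrite cospi in H1; rewrite cos0 in H2; rewrite H1.
Qed.

Lemma ler_cos : {in `[0, pi] &, {mono (@cos R) : x y /~ y <= x}}.
Proof. by move=> x y xI yI; rewrite !leNgt ltr_cos. Qed.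

End calculus.

(** * The sawtooth series *)

Section sawtooth.
Context {R : realType}.
Implicit Types (r : nat) (x : R).

Definition saw r x : R := \sum_(1 <= k < r.+1) sin (k%:R * x) / k%:R.

(** On []0, 2 pi[] the full series sums to [(pi - x) / 2], so this is its tail after [r] terms. *)
Definition saw_rem r x : R := (pi - x) / 2 - saw r x.

(** Each [2 * sin (x / 2) * cos (k x)] is a difference of sines at consecutive half-integer
    multiples of [x], so the sum telescopes. *)
Lemma dirichlet_kernel r x :
  2 * sin (x / 2) * (2^-1 + \sum_(1 <= k < r.+1) cos (k%:R * x)) =
  sin ((r%:R + 2^-1) * x).
Proof.
elim: r => [|r IH]; first by rewrite big_geq// addr0 add0r mulrAC mulfV// mul1r mulrC.
rewrite big_nat_recr//= addrA mulrDr IH -sin_sub_sin addrC -addrA.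
rewrite (_ : r.+1%:R * x - x / 2 = (r%:R + 2^-1) * x); last by rewrite -addn1 natrD; field.
by rewrite addNr addr0; congr (sin _); field.
Qed.

Lemma is_derive_saw r x : is_derive x 1 (saw r) (\sum_(1 <= k < r.+1) cos (k%:R * x)).
Proof.
apply: (@is_derive_sum_nat _ (fun k y => sin (k%:R * y) / k%:R)
  (fun k y => cos (k%:R * y))) => k k1.
by apply: is_derive_eq; rewrite /GRing.scale/=; field; rewrite pnatr_eq0 -lt0n.
Qed.

(** Termwise [|sin y| <= |y|]. This serves where [r x <= 1], a range in which the bound by the
    Dirichlet kernel is too weak. *)
Lemma saw_le r x : `|saw r x| <= r%:R * `|x|.
Proof.
rewrite (le_trans (ler_norm_sum _ _ _))//.
have -> : r%:R * `|x| = \sum_(1 <= k < r.+1) `|x|.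
  by rewrite sumr_const_nat subSS subn0 mulr_natl.
rewrite big_nat [leRHS]big_nat; apply: ler_sum => k /andP[k1 _].
have k0 : 0 < k%:R :> R by rewrite ltr0n.
rewrite normrM normfV (gtr0_norm k0) ler_pdivrMr//.
have -> : `|x| * k%:R = `|k%:R * x| by rewrite normrM (gtr0_norm k0) mulrC.
have := @le_norm_increment R (@sin R) idfun cos (cst 1) 0 `|k%:R * x| (normr_ge0 _).
rewrite sin0 !subr0/= => H.
have -> : `|sin (k%:R * x)| = `|sin `|k%:R * x| |.
  by have [_|_] := ger0P (k%:R * x); rewrite ?sinN ?normrN.
apply: (H _ _ _ _ _) => [||z _].
- by apply: continuous_subspaceT; exact: continuous_sin.
- by apply: continuous_subspaceT => z; exact: cvg_id.
- exact: cos_max.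
Qed.

(** Oddness about [pi], which carries bounds on []0, pi]] over to []pi, 2 pi[]. *)
Lemma saw_rem_2piB r x : saw_rem r (pi *+ 2 - x) = - saw_rem r x.
Proof.
rewrite /saw_rem opprB [X in _ - X](_ : _ = - saw r x).
  by rewrite opprK; lra.
rewrite /saw -sumrN; apply: eq_bigr => k _.
by rewrite mulrBr sinB sin_nat2pi cos_nat2pi mul0r mul1r sub0r mulNr.
Qed.

Lemma saw_pi r : saw r pi = 0.
Proof. by rewrite /saw big1// => k _; rewrite sin_natpi mul0r. Qed.

(** The derivative of [saw_rem] is [- sin (N y) / (2 sin (y / 2))]; integrating by parts from [x] to
    [pi], where [saw_rem] vanishes, gains the factor [1 / N]. The two boundary terms and the
    increment of [h] add up to at most [- 2 * h x]. *)
Lemma saw_rem_bound_pi r x : 0 < x <= pi ->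
  `|saw_rem r x| <= ((r%:R + 2^-1) * sin (x / 2))^-1.
Proof.
move=> /andP[x0 xpi].
set N : R := r%:R + 2^-1.
have N0 : 0 < N by rewrite ltr_wpDl.
have pi0 := @pi_gt0 R.
have s0 y : y \in `[x, pi] -> 0 < sin (y / 2).
  move=> /[!in_itv]/= /andP[xy ypi]; apply: sin_half_gt0.
  by rewrite (lt_le_trans x0 xy)/= mulr2n; lra.
(* The subtracted quotient is the boundary term of the integration by parts. What remains in the
   derivative of [f] is [cos (N * y) * dh y], dominated by the derivative of [h]. *)
pose f y := saw_rem r y - cos (N * y) / (2 * N * sin (y / 2)).
pose h (y : R) := - (2 * N * sin (y / 2))^-1.
pose dh y := cos (y / 2) / (4 * N * sin (y / 2) ^+ 2).
pose df y := - cos (N * y) * - dh y.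
have Hh y : y \in `[x, pi] -> is_derive y 1 h (dh y).
  move=> /s0 sy.
  have n0 : 2 * N * sin (y / 2) != 0 by rewrite !mulf_neq0// ?gt_eqF.
  apply: is_derive_eq; rewrite /GRing.scale/= /dh; field.
  by rewrite ?gt_eqF.
have Hf y : y \in `[x, pi] -> is_derive y 1 f (df y).
  move=> yI; have sy := s0 _ yI; rewrite /f.
  have n0 : 2 * N * sin (y / 2) != 0 by rewrite !mulf_neq0// ?gt_eqF.
  have Hsaw := is_derive_saw r y.
  have -> : (fun y0 => saw_rem r y0 - cos (N * y0) / (2 * N * sin (y0 / 2))) =
    (fun y0 => (pi - y0) / 2 - saw r y0 - cos (N * y0) / (2 * N * sin (y0 / 2))) by [].
  apply: is_derive_eq; rewrite /GRing.scale/=.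
  have := dirichlet_kernel r y; rewrite -/N => D.
  have -> : \sum_(1 <= k < r.+1) cos (k%:R * y) = sin (N * y) / (2 * sin (y / 2)) - 2^-1.
    by rewrite -D; field; rewrite gt_eqF.
  by rewrite /df /dh; field; rewrite !gt_eqF.
have le_fh : `|f pi - f x| <= h pi - h x.
  apply: (le_norm_increment xpi (fun y Hy => Hf y (subset_itv_oo_cc Hy))
    (fun y Hy => Hh y (subset_itv_oo_cc Hy)) (is_derive_within_continuous Hf)
    (is_derive_within_continuous Hh) _).
    move=> y /subset_itv_oo_cc yI; have := s0 _ yI.
    move: yI => /[!in_itv]/= /andP[xy ypi] sy.
    have dh0 : 0 <= dh y.
      have cy : 0 <= cos (y / 2) by apply: cos_ge0_pihalf; lra.
      by rewrite divr_ge0// !mulr_ge0 ?exprn_ge0// ltW.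
    by rewrite /df normrM !normrN (ger0_norm dh0) ler_piMl// cos_max.
have xI : x \in `[x, pi] by rewrite in_itv/= lexx.
have piI : pi \in `[x, pi] by rewrite in_itv/= lexx xpi.
have cb y : y \in `[x, pi] -> `|cos (N * y) / (2 * N * sin (y / 2))| <= - h y.
  move=> yI; have sy := s0 _ yI.
  have p0 : 0 < 2 * N * sin (y / 2) by rewrite !mulr_gt0.
  by rewrite /h opprK normrM normfV (gtr0_norm p0) ler_piMl ?cos_max// invr_ge0 ltW.
have := cb x xI; have := cb pi piI.
have -> : (N * sin (x / 2))^-1 = - h x *+ 2.
  by rewrite /h; field; rewrite !gt_eqF// s0.
move: le_fh; rewrite /f {1}/saw_rem saw_pi !subrr mul0r subrr sub0r !ler_norml mulr2n; lra.
Qed.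

Lemma saw_rem_bound r x : 0 < x < pi *+ 2 ->
  `|saw_rem r x| <= ((r%:R + 2^-1) * sin (x / 2))^-1.
Proof.
move=> /andP[x0 x2]; have [xpi|pix] := leP x pi.
  by apply: saw_rem_bound_pi; rewrite x0.
have := @saw_rem_bound_pi r (pi *+ 2 - x).
have -> : (pi *+ 2 - x) / 2 = pi - x / 2 by rewrite mulr2n; lra.
rewrite saw_rem_2piB normrN sinB sinpi cospi mul0r sub0r mulN1r opprK.
by apply; lra.
Qed.

(** A bound of order [1 / (r x)] is not integrable at [0], whereas [1 / sqrt (r x)] is, and it is
    integrated below up to the kink. For [r x <= 1] the remainder is bounded by a constant; for
    [r x > 1] the stronger bound [4 / (r x)] holds. *)
Lemma saw_rem_sqrt_bound r x : (0 < r)%N -> 0 < x <= pi ->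
  `|saw_rem r x| <= 4 / Num.sqrt (r%:R * x).
Proof.
move=> r0 xI; case/andP: (xI) => x0 xpi.
have R0 : 0 < r%:R :> R by rewrite ltr0n.
have rx0 : 0 < r%:R * x by rewrite mulr_gt0.
set u := r%:R * x in rx0 *.
have su0 : 0 < Num.sqrt u by rewrite sqrtr_gt0.
have suE : Num.sqrt u ^+ 2 = u by rewrite sqr_sqrtr// ltW.
have [u1|u1] := leP u 1.
  have su1 : Num.sqrt u <= 1 by rewrite -sqrtr1 ler_wsqrtr.
  apply: (@le_trans _ _ 4).
    have := saw_le r x; rewrite (gtr0_norm x0) -/u /saw_rem.
    have := @pihalf_lt2 R; rewrite !ler_norml; lra.
  by rewrite ler_pdivlMr// ler_piMr.
have su1 : 1 <= Num.sqrt u by rewrite -sqrtr1 ler_wsqrtr// ltW.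
rewrite (le_trans (saw_rem_bound_pi r xI))//.
have sx : x / 4 <= sin (x / 2).
  have := @sin_ge_half R (x / 2); lra.
rewrite ler_pdivlMr// ler_pdivrMl; last first.
  by rewrite mulr_gt0// ?ltr_wpDl// (lt_le_trans _ sx)// divr_gt0.
apply: (@le_trans _ _ u); first by rewrite -[leRHS]suE expr2 ler_peMr// ltW.
have : r%:R * (x / 4) <= (r%:R + 2^-1) * sin (x / 2).
  by apply: ler_pM => //; rewrite ?lerDl ?divr_ge0// ltW.
rewrite /u; lra.
Qed.

End sawtooth.

(** * The cosine series of a kink *)

Section kink_series.
Context {R : realType}.
Implicit Types (k r N : nat) (t u : R).

Definition kink t u : R := Num.max 0 (cos t - cos u).

(** The cosine coefficient [2 / pi] times the integral of [(cos t - cos u) * cos (k u)] over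
    [[t, pi]]. The cases [0] and [1] are separate because the general formula divides by [k] and by
    [k - 1]. *)
Definition kcoef t k : R :=
  match k with
  | 0 => 2 / pi * ((pi - t) * cos t + sin t)
  | 1 => pi^-1 * (t - pi - sin (2 * t) / 2)
  | _ => (pi * k%:R)^-1 *
         (sin ((k%:R - 1) * t) / (k%:R - 1) - sin ((k%:R + 1) * t) / (k%:R + 1))
  end.

Definition ksum r t u : R :=
  kcoef t 0 / 2 + \sum_(1 <= k < r.+1) kcoef t k * cos (k%:R * u).

Let pi_neq0 : pi != 0 :> R. Proof. by rewrite gt_eqF// pi_gt0. Qed.

Let piV_ge0 : 0 <= pi^-1 :> R. Proof. by rewrite invr_ge0 pi_ge0. Qed.

Let piV_le : pi^-1 <= 2^-1 :> R.
Proof. by rewrite lef_pV2 ?posrE ?pi_gt0 ?pi_ge2. Qed.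

Lemma natr_shift_neq0 k : (1 < k)%N ->
  [/\ (k%:R : R) != 0, (k%:R : R) - 1 != 0 & (k%:R : R) + 1 != 0].
Proof.
move=> k1; have : 1 < k%:R :> R by rewrite ltr1n.
by move=> ?; split; rewrite gt_eqF//; lra.
Qed.

(** This form separates orders of decay: the first term is [O (1 / k^3)], the second is of order
    [1 / k^2] and carries the main part of the tail. *)
Lemma kcoefE t k : (1 < k)%N ->
  kcoef t k = 2 / pi * (sin (k%:R * t) * cos t / (k%:R * (k%:R ^+ 2 - 1)) -
                        cos (k%:R * t) * sin t / (k%:R ^+ 2 - 1)).
Proof.
move=> k1; have [n0 n1 n2] := natr_shift_neq0 k1.
have n3 : k%:R ^+ 2 - 1 != 0 :> R.
  rewrite (_ : _ - 1 = (k%:R - 1) * (k%:R + 1)); last by ring.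
  exact: mulf_neq0.
have -> : kcoef t k = (pi * k%:R)^-1 *
  (sin ((k%:R - 1) * t) / (k%:R - 1) - sin ((k%:R + 1) * t) / (k%:R + 1)).
  by case: k k1 {n0 n1 n2 n3} => [|[]].
have -> : (k%:R - 1) * t = k%:R * t - t by ring.
have -> : (k%:R + 1) * t = k%:R * t + t by ring.
rewrite sinB sinD; move: (pi : R) pi_neq0 => p p0; field.
by rewrite n0 n1 n2 n3 p0.
Qed.

(** Differentiating the defining integral in [t], the integrand vanishes at the moving endpoint
    [u = t], and only [- sin t] times the integral of [cos (k u)] over [[t, pi]] survives. *)
Lemma is_derive_kcoef t k : (0 < k)%N ->
  is_derive t 1 (kcoef ^~ k) (2 / pi * sin t * (sin (k%:R * t) / k%:R)).
Proof.
case: k => [//|[|k]] _.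
  rewrite /kcoef; apply: is_derive_eq; rewrite /GRing.scale/= !mul1r.
  rewrite (_ : 2 * t = t *+ 2) ?cos_mulr2n; last by rewrite mulr2n; lra.
  have := cos2Dsin2 t => /(canRL (addrK _)) ->.
  by move: (pi : R) pi_neq0 => p p0; field.
have [n0 n1 n2] := natr_shift_neq0 (isT : (1 < k.+2)%N).
have -> : kcoef ^~ k.+2 = fun t => (pi * k.+2%:R)^-1 *
  (sin ((k.+2%:R - 1) * t) / (k.+2%:R - 1) - sin ((k.+2%:R + 1) * t) / (k.+2%:R + 1)) by [].
move: (k.+2%:R : R) n0 n1 n2 => K n0 n1 n2.
apply: is_derive_eq; rewrite /GRing.scale/=.
have -> : (K - 1) * t = K * t - t by ring.
have -> : (K + 1) * t = K * t + t by ring.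
rewrite cosB cosD.
by move: (pi : R) pi_neq0 => p p0; field; rewrite n0 n1 n2 p0.
Qed.

Lemma saw_oppr r t : saw r (- t) = - saw r t.
Proof.
by rewrite /saw -sumrN; apply: eq_bigr => k _; rewrite mulrN sinN mulNr.
Qed.

(** Product-to-sum turns the differentiated series into sawtooth sums at [t + u] and [t - u]; the
    constant coefficient contributes [- (pi - t)]. *)
Lemma is_derive_ksum r t u : is_derive t 1 (ksum r ^~ u)
  (sin t / pi * (saw r (t + u) + saw r (t - u) - (pi - t))).
Proof.
have H0 : is_derive t 1 (fun t => kcoef t 0 / 2) (sin t / pi * (- (pi - t))).
  rewrite /kcoef; apply: is_derive_eq; rewrite /GRing.scale/=.
  by move: (pi : R) pi_neq0 => p p0; field.
have H1 := @is_derive_sum_nat R (fun k t => kcoef t k * cos (k%:R * u))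
  (fun k t => 2 / pi * sin t * (sin (k%:R * t) / k%:R) * cos (k%:R * u)) 1 r.+1 t.
have : forall k : nat, (0 < k)%N -> is_derive t 1 (fun t => kcoef t k * cos (k%:R * u))
    (2 / pi * sin t * (sin (k%:R * t) / k%:R) * cos (k%:R * u)).
  move=> k k0; have := is_derive_kcoef t k0 => ?.
  by apply: is_derive_eq; rewrite /GRing.scale/=; ring.
move=> /H1 H2; have := is_deriveD H0 H2 => H3; apply: (@is_derive_eq _ _ _ _ _ _ _ _ H3).
rewrite [in RHS]addrC mulrDr; congr (_ + _).
rewrite /saw -big_split/= mulr_sumr; apply: eq_bigr => k _.
rewrite -mulrDl mulrDr mulrBr.
have -> : sin (k%:R * t + k%:R * u) + sin (k%:R * t - k%:R * u) =
  2 * (sin (k%:R * t) * cos (k%:R * u)) by rewrite sin_mul_cos; lra.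
by ring.
Qed.

(** At [t = pi] the function [kink] is identically zero, and so are its coefficients: the starting
    point for moving the kink. *)
Lemma ksum_pi r u : ksum r pi u = 0.
Proof.
rewrite /ksum {1}/kcoef subrr mul0r sinpi addr0 mulr0 mul0r add0r big_nat big1// => k /andP[k1 _].
suff -> : kcoef pi k = 0 by rewrite mul0r.
move: k1; rewrite leq_eqVlt => /predU1P[<-|k1].
  by rewrite /kcoef subrr (sin_natpi 2) mul0r subr0 mulr0.
by rewrite kcoefE// sin_natpi sinpi !mul0r mulr0 mul0r subr0 mulr0.
Qed.

(** Expand at half angles: [sin t = 2 * C * S], and [C * S <= C * S * (c + s) <= S * c + C * s],
    because [c + s >= c^2 + s^2 = 1]. *)
Lemma sin_le_mid t u : 0 <= t <= pi -> 0 <= u <= pi -> sin t <= 2 * sin ((t + u) / 2).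
Proof.
move=> /andP[t0 t1] /andP[u0 u1].
have -> : t = (t / 2) *+ 2 by rewrite mulr2n; lra.
rewrite [in leLHS]sin_mulr2n (_ : (t / 2 *+ 2 + u) / 2 = t / 2 + u / 2); last first.
  by rewrite mulr2n; lra.
rewrite sinD.
have H (x : R) : 0 <= x <= pi -> 0 <= sin (x / 2) <= 1 /\ 0 <= cos (x / 2) <= 1.
  move=> /andP[x0 x1]; rewrite sin_le1 cos_le1 !andbT; split.
    by apply: sin_ge0_pi; have := @pi_ge0 R; lra.
  by apply: cos_ge0_pihalf; have := @pi_ge0 R; lra.
have [/andP[S0 S1] /andP[C0 C1]] := H t (introT andP (conj t0 t1)).
have [/andP[s0 s1] /andP[c0 c1]] := H u (introT andP (conj u0 u1)).
have := cos2Dsin2 (u / 2).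
move: (sin (t / 2)) (cos (t / 2)) (sin (u / 2)) (cos (u / 2)) S0 S1 C0 C1 s0 s1 c0 c1.
move=> S C s c S0 S1 C0 C1 s0 s1 c0 c1 sc.
have sc1 : 1 <= c + s.
  rewrite -sc !expr2; apply: lerD; [exact: ler_piMr|exact: ler_piMr].
have SC0 : 0 <= C * S by exact: mulr_ge0.
have h1 : C * S * c <= S * c by apply: ler_wpM2r => //; exact: ler_piMl.
have h2 : C * S * s <= C * s by apply: ler_wpM2r => //; exact: ler_piMr.
have h3 : C * S <= C * S * (c + s) by exact: ler_peMr.
rewrite mulr2n; lra.
Qed.

(** The weight [sin t] coming from [is_derive_ksum] absorbs the factor [1 / sin ((t + u) / 2)],
    which makes the bound uniform as [t + u] nears [0] or [2 pi]. *)
Lemma sin_saw_rem_le r t u : (0 < r)%N -> 0 < t < pi -> 0 <= u <= pi ->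
  sin t * `|saw_rem r (t + u)| <= 2 / r%:R.
Proof.
move=> r0 /andP[t0 t1] /andP[u0 u1].
have R0 : 0 < r%:R :> R by rewrite ltr0n.
have tu : 0 < t + u < pi *+ 2 by rewrite mulr2n; lra.
have s0 := sin_half_gt0 tu.
have st0 : 0 <= sin t by apply: sin_ge0_pi; rewrite !ltW.
apply: le_trans (ler_wpM2l st0 (saw_rem_bound r tu)) _.
rewrite ler_pdivrMr ?mulr_gt0 ?ltr_wpDl//.
have H : sin t <= 2 * sin ((t + u) / 2).
  by apply: sin_le_mid; rewrite ?u0 ?u1// !ltW.
apply: (le_trans H); rewrite mulrA ler_pM2r//.
by rewrite mulrAC -mulrA ler_peMr// ler_pdivlMr// mul1r lerDl.
Qed.

Lemma sin_saw_rem_sqrt_le r t u : (0 < r)%N -> 0 < t < pi -> 0 < u <= pi ->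
  sin t * `|saw_rem r u| <= 4 / Num.sqrt (r%:R * u).
Proof.
move=> r0 /andP[t0 t1] uI.
have st0 : 0 <= sin t by apply: sin_ge0_pi; rewrite !ltW.
apply: le_trans (saw_rem_sqrt_bound r0 uI).
by rewrite ler_piMl// sin_le1.
Qed.

Lemma natV_le_sqrtV r : (0 < r)%N -> r%:R^-1 <= (Num.sqrt r%:R)^-1 :> R.
Proof.
move=> r0; have R0 : 0 < r%:R :> R by rewrite ltr0n.
rewrite lef_pV2 ?posrE ?sqrtr_gt0//.
apply: (@le_trans _ _ (Num.sqrt r%:R ^+ 2)); last by rewrite sqr_sqrtr// ltW.
by rewrite expr2 ler_peMr ?sqrtr_ge0// -[leLHS]sqrtr1 ler_wsqrtr// ler1n.
Qed.

Lemma sqrt_pi_le2 t : t <= pi -> Num.sqrt t <= 2.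
Proof.
move=> tpi; rewrite -(ger0_norm (_ : 0 <= 2))// -sqrtr_sqr ler_wsqrtr//.
by have := @pihalf_lt2 R; rewrite expr2; lra.
Qed.

Lemma sqrt_increment_le r t0 t1 : (0 < r)%N -> 0 <= t1 - t0 <= pi ->
  (t1 - t0) / r%:R + 4 * Num.sqrt (t1 - t0) / Num.sqrt r%:R <= 12 / Num.sqrt r%:R.
Proof.
move=> r0 /andP[h0 h1].
have H := natV_le_sqrtV r0.
have s0 : 0 <= (Num.sqrt r%:R)^-1 :> R by rewrite invr_ge0 sqrtr_ge0.
have H1 : (t1 - t0) / r%:R <= 4 / Num.sqrt r%:R.
  by apply: ler_pM => //; have := @pihalf_lt2 R; lra.
have H2 : 4 * Num.sqrt (t1 - t0) / Num.sqrt r%:R <= 8 / Num.sqrt r%:R.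
  by rewrite ler_wpM2r//; have := sqrt_pi_le2 h1; lra.
lra.
Qed.

(** Here [kink t u = 0]. The kink is moved from [pi], where [ksum] vanishes, down to [t]; above [u]
    the derivative is [- sin v / pi] times the sum of the sawtooth remainders at [v + u] and
    [v - u]. *)
Lemma ksum_above r t u : (0 < r)%N -> 0 <= u <= t -> t <= pi ->
  `|ksum r t u| <= 12 / Num.sqrt r%:R.
Proof.
move=> r0 /andP[u0 ut] tpi; have R0 : 0 < r%:R :> R by rewrite ltr0n.
(* A primitive of half the sum of the bounds [2 / r] and [4 / sqrt (r (v - u))]; the half comes from
   [1 / pi <= 1 / 2]. *)
pose h v : R := v / r%:R + 4 * Num.sqrt (v - u) / Num.sqrt r%:R.
pose dh v : R := r%:R^-1 + 2 / (Num.sqrt (v - u) * Num.sqrt r%:R).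
have Hh v : v \in `]t, pi[ -> is_derive v 1 h (dh v).
  move=> /[!in_itv]/= /andP[tv _].
  have vu : 0 < v - u by lra.
  have ? := is_derive1_sqrt vu.
  rewrite /h; apply: is_derive_eq; rewrite /GRing.scale/= /dh; field.
  by rewrite !gt_eqF ?sqrtr_gt0.
have ch : {within `[t, pi], continuous h}.
  apply: continuous_subspaceT => v; apply: cvgD.
    by apply: cvgM; [exact: cvg_id|exact: cvg_cst].
  apply: cvgM; last exact: cvg_cst.
  apply: cvgM; first exact: cvg_cst.
  apply: (@continuous_comp _ _ _ (fun v => v - u) Num.sqrt); last exact: sqrt_continuous.
  by apply: cvgB; [exact: cvg_id|exact: cvg_cst].
have Hf v : v \in `[t, pi] -> is_derive v 1 (ksum r ^~ u) _ := fun _ => is_derive_ksum r v u.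
have := le_norm_increment tpi (fun v Hv => Hf v (subset_itv_oo_cc Hv)) Hh
  (is_derive_within_continuous Hf) ch.
rewrite ksum_pi sub0r normrN => H; apply: le_trans (H _) _ => {H}.
  move=> v /[!in_itv]/= /andP[tv vpi].
  have -> : saw r (v + u) + saw r (v - u) - (pi - v) =
     - (saw_rem r (v + u) + saw_rem r (v - u)) by rewrite /saw_rem; lra.
  have vI : 0 < v < pi by lra.
  have st0 : 0 <= sin v by apply: sin_ge0_pi; rewrite !ltW//; lra.
  have vuI : 0 < v - u <= pi by lra.
  have uI : 0 <= u <= pi by lra.
  have H1 := sin_saw_rem_le r0 vI uI.
  have H2 := sin_saw_rem_sqrt_le r0 vI vuI.
  rewrite normrM normrN normrM normfV (gtr0_norm (@pi_gt0 R)) (ger0_norm st0) mulrAC.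
  apply: (@le_trans _ _ ((2 / r%:R + 4 / Num.sqrt (r%:R * (v - u))) / 2)).
    apply: ler_pM => //; first by rewrite mulr_ge0.
    apply: le_trans (lerD H1 H2); rewrite -mulrDr ler_wpM2l//; exact: ler_normD.
  rewrite /dh (sqrtrM _ (ltW R0)).
  rewrite le_eqVlt; apply/orP; left; apply/eqP; field; rewrite !gt_eqF ?sqrtr_gt0//; lra.
apply: le_trans (sqrt_increment_le r0 (_ : 0 <= pi - u <= pi)); last by lra.
rewrite /h -subr_ge0.
have : 0 <= 4 * Num.sqrt (t - u) / Num.sqrt r%:R by rewrite !mulr_ge0 ?invr_ge0 ?sqrtr_ge0.
have : 0 <= (t - u) / r%:R by rewrite divr_ge0//; lra.
lra.
Qed.

(** Below the diagonal [kink t u] is [cos t - cos u]. Its derivative [- sin t] is what turns the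
    sawtooth at the negative argument [t - u] into a remainder at [u - t], so the kink can be moved
    from [t] up to [u]. *)
Lemma ksum_below r t u : (0 < r)%N -> 0 < t <= u -> u <= pi ->
  `|ksum r u u - (ksum r t u - (cos t - cos u))| <= 12 / Num.sqrt r%:R.
Proof.
move=> r0 /andP[t0 tu] upi; have R0 : 0 < r%:R :> R by rewrite ltr0n.
pose h v : R := v / r%:R - 4 * Num.sqrt (u - v) / Num.sqrt r%:R.
pose dh v : R := r%:R^-1 + 2 / (Num.sqrt (u - v) * Num.sqrt r%:R).
pose f v : R := ksum r v u - (cos v - cos u).
pose df v : R := sin v / pi * (saw r (v + u) + saw r (v - u) - (pi - v)) + sin v.
have Hh v : v \in `]t, u[ -> is_derive v 1 h (dh v).
  move=> /[!in_itv]/= /andP[_ vu].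
  have uv : 0 < u - v by lra.
  have ? := is_derive1_sqrt uv.
  rewrite /h; apply: is_derive_eq; rewrite /GRing.scale/= /dh; field.
  by rewrite !gt_eqF ?sqrtr_gt0.
have ch : {within `[t, u], continuous h}.
  apply: continuous_subspaceT => v; apply: cvgB.
    by apply: cvgM; [exact: cvg_id|exact: cvg_cst].
  apply: cvgM; last exact: cvg_cst.
  apply: cvgM; first exact: cvg_cst.
  apply: (@continuous_comp _ _ _ (fun v => u - v) Num.sqrt); last exact: sqrt_continuous.
  by apply: cvgB; [exact: cvg_cst|exact: cvg_id].
have Hf v : v \in `[t, u] -> is_derive v 1 f (df v).
  move=> _; have ? := is_derive_ksum r v u.
  by rewrite /f; apply: is_derive_eq; rewrite /df; lra.
have := le_norm_increment tu (fun v Hv => Hf v (subset_itv_oo_cc Hv)) Hh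
  (is_derive_within_continuous Hf) ch.
rewrite {1}/f subrr subr0 => H; apply: le_trans (H _) _ => {H}.
  move=> v /[!in_itv]/= /andP[tv vu].
  have -> : df v = sin v / pi * (saw_rem r (u - v) - saw_rem r (v + u)).
    rewrite /df -[v - u]opprB saw_oppr /saw_rem.
    by move: (pi : R) pi_neq0 => p p0; field.
  have vI : 0 < v < pi by lra.
  have st0 : 0 <= sin v by apply: sin_ge0_pi; rewrite !ltW//; lra.
  have vuI : 0 < u - v <= pi by lra.
  have uI : 0 <= u <= pi by lra.
  have H1 := sin_saw_rem_le r0 vI uI.
  have H2 := sin_saw_rem_sqrt_le r0 vI vuI.
  rewrite !normrM normfV (gtr0_norm (@pi_gt0 R)) (ger0_norm st0) mulrAC.
  apply: (@le_trans _ _ ((2 / r%:R + 4 / Num.sqrt (r%:R * (u - v))) / 2)).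
    apply: ler_pM => //; first by rewrite mulr_ge0.
    apply: le_trans (lerD H1 H2); rewrite -mulrDr ler_wpM2l// [leRHS]addrC.
    exact: ler_normB.
  rewrite /dh (sqrtrM _ (ltW R0)).
  rewrite le_eqVlt; apply/orP; left; apply/eqP; field; rewrite !gt_eqF ?sqrtr_gt0//; lra.
apply: le_trans (sqrt_increment_le r0 (_ : 0 <= u - t <= pi)); last by lra.
by rewrite /h subrr sqrtr0; lra.
Qed.

(** For [u > t] the path goes through the diagonal [t = u], hence twice the constant [12]. The rate
    is crude, but only convergence is needed from it. *)
Lemma ksum_cvg r t u : (0 < r)%N -> 0 < t <= pi -> 0 <= u <= pi ->
  `|kink t u - ksum r t u| <= 24 / Num.sqrt r%:R.
Proof.
move=> r0 /andP[t0 tpi] /andP[u0 upi].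
have s0 : 0 <= (Num.sqrt r%:R)^-1 :> R by rewrite invr_ge0 sqrtr_ge0.
rewrite /kink; have [ut|tu] := leP u t.
  rewrite max_l ?sub0r ?normrN.
    by apply: le_trans (ksum_above r0 _ tpi) _; rewrite ?u0//; lra.
  rewrite subr_le0; move: ut; rewrite le_eqVlt => /predU1P[->//|ut].
  by apply/ltW; rewrite ltr_cos// in_itv/=; lra.
rewrite max_r; last first.
  by rewrite subr_ge0 ltW// ltr_cos// in_itv/=; lra.
have H1 := @ksum_above r u u r0; have H2 := @ksum_below r t u r0.
have := H1 (introT andP (conj u0 (lexx u))) upi.
have := H2 (introT andP (conj t0 (ltW tu))) upi.
rewrite !ler_norml; lra.
Qed.

End kink_series.

(** * Size of the remainder *)

Section tail.
Context {R : realType}.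
Implicit Types (k r N : nat) (t u : R).

Lemma abel_sum_bound (d s : nat -> R) p n :
  (forall k, (p <= k)%N -> 0 <= d k) ->
  (forall k, (p <= k)%N -> d k.+1 <= d k) ->
  (forall k, `|s k| <= 1) ->
  `|\sum_(p <= k < p + n) d k * (s k.+1 - s k)| <= 2 * d p.
Proof.
move=> d0 dS s1; case: n => [|n].
  by rewrite addn0 big_geq// normr0 mulr_ge0 ?d0.
(* Summation by parts with its upper boundary term taken out; in this form the bound is stable under
   adding one more term. *)
suff : `|\sum_(p <= k < p + n.+1) d k * (s k.+1 - s k) - d (p + n)%N * s (p + n).+1|
       <= 2 * d p - d (p + n)%N.
  have := s1 (p + n).+1; have := d0 (p + n)%N (leq_addr _ _).
  move: (d (p + n)%N) (s (p + n).+1) => D S D0 S1.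
  have : `|D * S| <= D by rewrite normrM (ger0_norm D0) ler_piMr.
  rewrite !ler_norml; lra.
elim: n => [|n IH].
  rewrite addn1 big_nat1 addn0 (_ : _ - _ = - (d p * s p)); last by ring.
  by rewrite normrN normrM ger0_norm ?d0// (_ : 2 * d p - d p = d p) ?ler_piMr ?d0//; lra.
rewrite addnS big_nat_recr ?leq_addr//=; move: IH.
have := dS (p + n)%N (leq_addr _ _); have := s1 (p + n).+1.
rewrite !addnS; move: (\sum_(_ <= _ < _) _) (d (p + n)%N) (d (p + n).+1) => A D D'.
move: (s (p + n).+1) (s (p + n).+2) => S S' S1 DD' IH.
have -> : A + D' * (S' - S) - D' * S' = (A - D * S) + (D - D') * S by ring.
have : `|(D - D') * S| <= D - D'.
  by rewrite normrM ger0_norm ?subr_ge0// ler_piMr// subr_ge0.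
move: IH; rewrite !ler_norml; lra.
Qed.

(** Multiplied by [2 * sin (x / 2)], the cosines become consecutive differences of
    [sin ((k - 1/2) x)], to which [abel_sum_bound] applies. *)
Lemma abel_sum_cos_bound (d : nat -> R) p n x :
  (forall k, (p <= k)%N -> 0 <= d k) ->
  (forall k, (p <= k)%N -> d k.+1 <= d k) ->
  `|sin (x / 2) * \sum_(p <= k < p + n) d k * cos (k%:R * x)| <= d p.
Proof.
move=> d0 dS.
have := @abel_sum_bound d (fun k => sin ((k%:R - 2^-1) * x)) p n d0 dS
  (fun k => sin_max _).
rewrite (eq_bigr (fun k => 2 * sin (x / 2) * (d k * cos (k%:R * x)))); last first.
  move=> k _; have := sin_sub_sin (k%:R * x) (x / 2).
  rewrite (_ : (k.+1%:R - 2^-1) * x = k%:R * x + x / 2); last by rewrite -natr1; field.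
  rewrite (_ : (k%:R - 2^-1) * x = k%:R * x - x / 2); last by field.
  by move=> ->; ring.
rewrite -mulr_sumr -mulrA normrM ger0_norm// ler_pM2l//.
Qed.

Definition invsqrB1 k : R := (k%:R ^+ 2 - 1)^-1.

Lemma invsqrB1E k : (1 < k)%N -> invsqrB1 k = ((k%:R - 1)^-1 - (k%:R + 1)^-1) / 2.
Proof.
move=> k1; have [_ n1 n2] := @natr_shift_neq0 R k k1.
rewrite /invsqrB1 (_ : k%:R ^+ 2 - 1 = (k%:R - 1) * (k%:R + 1)); last by ring.
by field; rewrite n1 n2.
Qed.

Lemma invsqrB1_gt0 k : (1 < k)%N -> 0 < invsqrB1 k.
Proof. by move=> k1; rewrite invr_gt0 subr_gt0 exprn_egt1 ?ltr1n. Qed.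

Lemma invsqrB1_decr k : (1 < k)%N -> invsqrB1 k.+1 <= invsqrB1 k.
Proof.
move=> k1; rewrite lef_pV2 ?posrE ?subr_gt0 ?exprn_egt1 ?ltr1n//; last exact: ltnW.
by rewrite lerB// lerXn2r ?nnegrE// ler_nat.
Qed.

(** The partial fractions of [invsqrB1E] telescope with step two, leaving two terms at each end. *)
Lemma sum_invsqrB1 r N : (0 < r <= N)%N ->
  \sum_(r.+1 <= k < N.+1) invsqrB1 k =
  (r%:R^-1 + r.+1%:R^-1 - N%:R^-1 - N.+1%:R^-1) / 2.
Proof.
move=> /andP[r0 rN]; rewrite -(subnKC rN); elim: (N - r)%N => [|n IH].
  by rewrite addn0 big_geq//; ring.
rewrite addnS big_nat_recr/= ?ltnS ?leq_addr// IH invsqrB1E ?ltnS ?ltn_addr//.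
rewrite -[(r + n).+2%:R]natr1 -[in (_ - 1)](natr1 (r + n)) addrK; ring.
Qed.

Lemma sum_invsqrB1_le r N : (0 < r <= N)%N -> \sum_(r.+1 <= k < N.+1) invsqrB1 k <= r%:R^-1.
Proof.
move=> rN; rewrite sum_invsqrB1//; case/andP: rN => r0 rN.
have : r.+1%:R^-1 <= r%:R^-1 :> R by rewrite lef_pV2 ?posrE ?ltr0n// ler_nat.
have : 0 <= N%:R^-1 :> R by rewrite invr_ge0.
have : 0 <= N.+1%:R^-1 :> R by rewrite invr_ge0.
by move: (r%:R^-1) (r.+1%:R^-1) (N%:R^-1) (N.+1%:R^-1) => *; lra.
Qed.

Lemma sum_invsqrB1_ge r N : (0 < r <= N)%N ->
  r.+1%:R^-1 - N%:R^-1 <= \sum_(r.+1 <= k < N.+1) invsqrB1 k.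
Proof.
move=> rN; rewrite sum_invsqrB1//; case/andP: rN => r0 rN.
have : r.+1%:R^-1 <= r%:R^-1 :> R by rewrite lef_pV2 ?posrE ?ltr0n// ler_nat.
have N0 := leq_trans r0 rN.
have : N.+1%:R^-1 <= N%:R^-1 :> R by rewrite lef_pV2 ?posrE ?ltr0n// ler_nat.
by move: (r%:R^-1) (r.+1%:R^-1) (N%:R^-1) (N.+1%:R^-1) => *; lra.
Qed.

Let pi0 : 0 < pi :> R := pi_gt0 R.

Let piV_ge0 : 0 <= pi^-1 :> R. Proof. by rewrite invr_ge0 pi_ge0. Qed.

Let piV_le : pi^-1 <= 2^-1 :> R.
Proof. by rewrite lef_pV2 ?posrE ?pi_gt0 ?pi_ge2. Qed.

(* Product-to-sum on [cos (k t) cos (k u)]: the [k (t - u)] part carries the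
   main term and, as [t + u] stays away from [0] and [2 pi], the other parts are
   [O (1 / r^2)]. *)
Lemma kcoef_tail r N t u : (0 < r <= N)%N -> 0 < t < pi -> 0 <= u <= pi ->
  `|\sum_(r.+1 <= k < N.+1) kcoef t k * cos (k%:R * u) +
    sin t / pi * \sum_(r.+1 <= k < N.+1) invsqrB1 k * cos (k%:R * (t - u))| <=
  2 / r%:R ^+ 2.
Proof.
move=> rN /andP[t0 tpi] /andP[u0 upi]; case/andP: (rN) => r0 _.
have R0 : 0 < r%:R :> R by rewrite ltr0n.
(* [A] collects the cubically decaying terms of [kcoefE], and [B] the [t + u] half of the
   product-to-sum formula. Each contributes at most [1 / r^2]. *)
pose A := \sum_(r.+1 <= k < N.+1)
  invsqrB1 k * (2 / pi * (sin (k%:R * t) * cos t / k%:R * cos (k%:R * u))).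
pose B := \sum_(r.+1 <= k < N.+1) invsqrB1 k * cos (k%:R * (t + u)).
rewrite [X in `|X|](_ : _ = A - sin t / pi * B); last first.
  rewrite /A /B !mulr_sumr -big_split -sumrB/=.
  rewrite big_nat [in RHS]big_nat; apply: eq_bigr => k /andP[rk _].
  have k1 : (1 < k)%N by rewrite (leq_trans _ rk).
  rewrite kcoefE// [k%:R * (t - u)]mulrBr [k%:R * (t + u)]mulrDr cosB cosD /invsqrB1.
  move: (k%:R ^+ 2 - 1) => q.
  rewrite invfM; ring.
have leA : `|A| <= (r%:R ^+ 2)^-1.
  rewrite (le_trans (ler_norm_sum _ _ _))//.
  apply: (@le_trans _ _ (\sum_(r.+1 <= k < N.+1) invsqrB1 k * r%:R^-1)); last first.
    by rewrite -mulr_suml expr2 invfM ler_pM2r ?invr_gt0// sum_invsqrB1_le.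
  rewrite big_nat [leRHS]big_nat; apply: ler_sum => k /andP[rk _].
  have k1 : (1 < k)%N by rewrite (leq_trans _ rk).
  rewrite normrM (gtr0_norm (invsqrB1_gt0 k1)) ler_pM2l ?invsqrB1_gt0//.
  have k0 : 0 < k%:R :> R by rewrite ltr0n ltnW.
  have kr : k%:R^-1 <= r%:R^-1 :> R by rewrite lef_pV2 ?posrE// ler_nat ltnW.
  rewrite (_ : 2 / pi * _ =
    (sin (k%:R * t) * cos t * cos (k%:R * u)) * (2 / pi) * k%:R^-1); last by ring.
  rewrite normrM normfV (gtr0_norm k0); apply: le_trans kr.
  rewrite ler_piMl ?invr_ge0 ?(ltW k0)// normrM.
  rewrite (ger0_norm (_ : 0 <= 2 / pi)); last by rewrite mulr_ge0.
  have pi1 : 2 / pi <= 1 :> R by rewrite ler_pdivrMr ?mul1r ?pi_ge2.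
  apply: mulr_ile1 => //; first by rewrite mulr_ge0.
  by rewrite !normrM !mulr_ile1 ?mulr_ge0 ?sin_max ?cos_max.
(* Abel summation bounds [sin ((t + u) / 2) * B]; [sin_le_mid] trades that factor for [sin t], which
   may be small at the same time. *)
have leB : sin t * `|B| <= 2 / r%:R ^+ 2.
  have st0 : 0 <= sin t by apply: sin_ge0_pi; rewrite !ltW.
  have sle : sin t <= 2 * sin ((t + u) / 2).
    by apply: sin_le_mid; rewrite ?u0 ?upi// !ltW.
  have s0 : 0 < sin ((t + u) / 2).
    by apply: sin_half_gt0; rewrite mulr2n; lra.
  have := @abel_sum_cos_bound invsqrB1 r.+1 (N - r)%N (t + u).
  rewrite addSn subnKC; last by case/andP: rN.
  rewrite -/B normrM (gtr0_norm s0) => leB.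
  apply: (@le_trans _ _ (2 * invsqrB1 r.+1)).
    apply: (le_trans (ler_wpM2r (normr_ge0 _) sle)); rewrite -mulrA ler_pM2l// leB//.
      by move=> k rk; apply/ltW/invsqrB1_gt0; exact: leq_trans rk.
    by move=> k rk; apply/invsqrB1_decr; exact: leq_trans rk.
  rewrite ler_pM2l// lef_pV2 ?posrE ?exprn_gt0//; last first.
    by rewrite subr_gt0 exprn_egt1 ?ltr1n.
  by rewrite -natr1; have := sqr_ge0 (r%:R : R); rewrite !expr2; lra.
apply: le_trans (ler_normB _ _) _.
have -> : `|sin t / pi * B| = sin t * `|B| / pi.
  have st0 : 0 <= sin t by apply: sin_ge0_pi; rewrite !ltW.
  rewrite !normrM normfV (gtr0_norm pi0) (ger0_norm st0).
  by rewrite mulrAC.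
have : sin t * `|B| / pi <= 2 / r%:R ^+ 2 * 2^-1.
  by apply: ler_pM => //; rewrite mulr_ge0// sin_ge0_pi// !ltW.
lra.
Qed.

Lemma exists_div_sqrt_lt r (C e : R) : 0 <= C -> 0 < e ->
  exists N : nat, [/\ (0 < N)%N, (r <= N)%N & C / Num.sqrt N%:R < e].
Proof.
move=> C0 e0; pose N := ((Num.bound ((C / e) ^+ 2)) + r)%N.
have N0 : (C / e) ^+ 2 < N%:R.
  rewrite natrD (@lt_le_trans _ _ (Num.bound ((C / e) ^+ 2))%:R)//.
    by apply: archi_boundP; exact: sqr_ge0.
  by rewrite lerDl.
have NR0 : 0 < N%:R :> R by apply: le_lt_trans N0; exact: sqr_ge0.
exists N; split; [by rewrite -(ltr0n R)|exact: leq_addl|].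
rewrite ltr_pdivrMr ?sqrtr_gt0// mulrC -ltr_pdivrMr//.
by rewrite -(ger0_norm (divr_ge0 C0 (ltW e0))) -sqrtr_sqr ltr_sqrt.
Qed.

Lemma ksum_sub r N t u : (r <= N)%N ->
  ksum N t u - ksum r t u = \sum_(r.+1 <= k < N.+1) kcoef t k * cos (k%:R * u).
Proof. by move=> rN; rewrite /ksum (big_cat_nat _ (n := r.+1))//=; lra. Qed.

(** The series is compared at a finite stage [N] so late that [ksum N] is within [e] of the kink;
    the terms from [r + 1] to [N] are then bounded independently of [N]. *)
Lemma kink_err_le r t u : (0 < r)%N -> 0 < t < pi -> 0 <= u <= pi ->
  `|kink t u - ksum r t u| <= sin t / (pi * r%:R) + 2 / r%:R ^+ 2.
Proof.
move=> r0 tI uI; case/andP: (tI) => t0 tpi; apply/ler_addgt0Pr => e e0.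
have [N [N0 rN Ne]] := @exists_div_sqrt_lt r 24 e (ler0n _ _) e0.
have rN0 : (0 < r <= N)%N by rewrite r0.
have H1 : `|kink t u - ksum N t u| <= 24 / Num.sqrt N%:R.
  by apply: ksum_cvg => //; rewrite t0 ltW.
have H2 := kcoef_tail rN0 tI uI.
have H3 : `|sin t / pi * \sum_(r.+1 <= k < N.+1) invsqrB1 k * cos (k%:R * (t - u))|
    <= sin t / (pi * r%:R).
  have st0 : 0 <= sin t / pi.
    by rewrite mulr_ge0// sin_ge0_pi// !ltW.
  rewrite invfM mulrA normrM (ger0_norm st0) ler_wpM2l//.
  rewrite (le_trans (ler_norm_sum _ _ _))// (le_trans _ (sum_invsqrB1_le rN0))//.
  rewrite big_nat [leRHS]big_nat; apply: ler_sum => k /andP[rk _].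
  have k1 : (1 < k)%N by rewrite (leq_trans _ rk).
  by rewrite normrM (gtr0_norm (invsqrB1_gt0 k1)) ler_piMr ?cos_max// ltW// invsqrB1_gt0.
rewrite (_ : kink t u - _ = (kink t u - ksum N t u) + (ksum N t u - ksum r t u)); last by ring.
rewrite ksum_sub//; move: H1 H2 H3 Ne.
move: (_ - ksum N t u) (\sum_(_ <= _ < _) kcoef _ _ * _) (_ * \sum_(_ <= _ < _) _) => a b c.
move: (24 / _) (sin t / _) (2 / _) => A B C.
rewrite !ler_norml; lra.
Qed.

(** At [u = t] every cosine of the main term equals [1], so nothing cancels and the bound of
    [kink_err_le] is attained to first order. *)
Lemma kink_err_ge r t : (0 < r)%N -> 0 < t < pi ->
  sin t / (pi * r.+1%:R) - 2 / r%:R ^+ 2 <= `|kink t t - ksum r t t|.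
Proof.
move=> r0 tI; case/andP: (tI) => t0 tpi; rewrite lerBlDr; apply/ler_addgt0Pr => e e0.
(* [25 = 24 + 1]: the convergence error, plus the [1 / N <= 1 / sqrt N] lost by stopping the sum at
   [N]. *)
have [N [N0 rN Ne]] := @exists_div_sqrt_lt r 25 e (ler0n _ _) e0.
have rN0 : (0 < r <= N)%N by rewrite r0.
have tI' : 0 <= t <= pi by rewrite !ltW.
have H1 : `|kink t t - ksum N t t| <= 24 / Num.sqrt N%:R.
  by apply: ksum_cvg => //; rewrite t0 ltW.
have H2 := kcoef_tail rN0 tI tI'.
have st0 : 0 <= sin t / pi.
  by rewrite mulr_ge0// sin_ge0_pi.
have st1 : sin t / pi <= 1.
  rewrite ler_pdivrMr// mul1r (le_trans (sin_le1 _))//.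
  by rewrite (le_trans _ (@pi_ge2 R))// ler1n.
have H3 : sin t / (pi * r.+1%:R) - (Num.sqrt N%:R)^-1 <=
    sin t / pi * \sum_(r.+1 <= k < N.+1) invsqrB1 k * cos (k%:R * (t - t)).
  rewrite (eq_bigr invsqrB1) => [|k _]; last by rewrite subrr mulr0 cos0 mulr1.
  apply: (le_trans _ (ler_wpM2l st0 (sum_invsqrB1_ge rN0))).
  rewrite mulrBr invfM mulrA lerB//.
  by apply: le_trans (natV_le_sqrtV N0); rewrite ler_piMl// invr_ge0.
rewrite (_ : kink t t - ksum r t t =
  (kink t t - ksum N t t) + (ksum N t t - ksum r t t)); last by ring.
rewrite ksum_sub//; move: H1 H2 H3 Ne.
move: (_ - ksum N t t) (\sum_(_ <= _ < _) kcoef _ _ * _) (_ * \sum_(_ <= _ < _) _) => a b c.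
move: (Num.sqrt N%:R)^-1 (sin t / _) (2 / _) => A B C.
rewrite !ler_norml => H1 H2 H3 H4.
have := ler_norm (- (a + b)); rewrite normrN; lra.
Qed.

End tail.

(** * Chebyshev coefficients *)

Section cos_substitution.
Context {R : realType}.
Implicit Types (t u s : R).
Notation mu := (@lebesgue_measure R).
Variables (Psi psi : R -> R) (t : R).
Hypothesis tI : 0 < t < pi.
Hypothesis dPsi : forall u, is_derive u 1 Psi (- psi u).
Hypothesis cpsi : continuous psi.

(** The minus sign in [dPsi] cancels the one in the derivative of [acos], so [Psi \o acos] is a
    primitive on []-1, 1[]. *)
Definition acos_integrand s := psi (acos s) / Num.sqrt (1 - s ^+ 2).

Lemma is_derive_comp_acos s : -1 < s < 1 ->
  is_derive s 1 (Psi \o acos) (acos_integrand s).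
Proof.
move=> sI; have ? := is_derive1_acos sI; have ? := dPsi (acos s).
by apply: is_derive_eq; rewrite /acos_integrand; ring.
Qed.

Lemma continuous_acos_integrand s : -1 < s < 1 -> {for s, continuous acos_integrand}.
Proof.
move=> sI; have ca := continuous_acos sI.
apply: cvgM; first by apply: cvg_comp; [exact: ca|exact: cpsi].
apply: cvgV.
  rewrite gt_eqF// sqrtr_gt0; case/andP: sI => s1 s2; rewrite expr2; nra.
apply: (@continuous_comp _ _ _ (fun s => 1 - s ^+ 2) Num.sqrt); last exact: sqrt_continuous.
apply: cvgB; first exact: cvg_cst.
exact: exprn_continuous.
Qed.

Lemma acos_integrand_FTC u : t < u < pi ->
  (\int[mu]_(s in `[cos u, cos t]) (acos_integrand s)%:E = (Psi t - Psi u)%:E)%E.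
Proof.
case/andP: tI => t0 tpi /andP[tu upi].
have /andP[cu cu1] := @cos_bound_oo R u (introT andP (conj (lt_trans t0 tu) upi)).
have /andP[ct ct1] := cos_bound_oo tI.
have cut : cos u < cos t by rewrite ltr_cos ?in_itv/=; lra.
have sI s : s \in `[cos u, cos t] -> -1 < s < 1.
  by rewrite in_itv/= => /andP[? ?]; lra.
have cont s : s \in `[cos u, cos t] -> {for s, continuous (Psi \o acos)}.
  by move=> /sI /is_derive_comp_acos; exact: is_derive_continuous.
rewrite (@continuous_FTC2 _ _ (Psi \o acos) _ _ cut).
- by rewrite /= !cosK ?in_itv/= ?EFinB//; lra.
- apply: continuous_in_subspaceT => s; rewrite inE/= => /sI.
  exact: continuous_acos_integrand.
- split.
  + by move=> s /subset_itv_oo_cc /sI /is_derive_comp_acos ?; exact: ex_derive.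
  + by apply/cvg_at_right_filter/cont; rewrite in_itv/= lexx ltW.
  + by apply/cvg_at_left_filter/cont; rewrite in_itv/= lexx ltW.
- move=> s /subset_itv_oo_cc /sI /is_derive_comp_acos ?.
  by rewrite derive1E; exact: derive_val.
Qed.

Lemma measurable_acos_integrand :
  measurable_fun `]-1, cos t] acos_integrand.
Proof.
have /andP[ct ct1] := cos_bound_oo tI.
have H : measurable_fun (`](-1 : R), 1[%classic : set R) acos_integrand.
  apply: open_continuous_measurable_fun => //.
  by move=> s; rewrite inE/= in_itv/=; exact: continuous_acos_integrand.
apply: measurable_funS H => //.
by apply: subset_itvl; rewrite bnd_simp.
Qed.

Hypothesis psi_ge0 : forall u, u \in `[t, pi] -> 0 <= psi u.

(** The integrand may blow up at [-1]. The fundamental theorem is applied on compact intervals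
    exhausting []-1, cos t]], followed by monotone convergence, which is where [psi >= 0] is
    needed. *)
Lemma ge0_integral_acos :
  (\int[mu]_(s in `](-1)%R, cos t]) (acos_integrand s)%:E = (Psi t - Psi pi)%:E)%E.
Proof.
case/andP: (tI) => t0 tpi.
(* Angles increasing to [pi]; starting the denominators at [2] keeps [a 0] strictly above [t]. *)
pose a n : R := pi - (pi - t) / n.+2%:R.
have aI n : t < a n < pi.
  have n0 : 0 < n.+2%:R :> R by [].
  have n1 : 1 < n.+2%:R :> R by rewrite ltr1n.
  have := divr_gt0 (_ : 0 < pi - t) n0; rewrite subr_gt0 => /(_ tpi) p0.
  have : (pi - t) / n.+2%:R < pi - t by rewrite ltr_pdivrMr// ltr_pMr ?subr_gt0.
  by rewrite /a; move: (_ / _) p0 => d; lra.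
have aI' n : a n \in `[0, pi]%R by rewrite in_itv/=; have := aI n; lra.
pose F n := [set` `[cos (a n), cos t]%R].
have FE : `]-1, cos t]%classic = \bigcup_n F n.
  apply/seteqP; split => s; rewrite /F/= in_itv/=.
    move=> /andP[s1 st].
    have s1' : s <= 1 by rewrite (le_trans st)// cos_le1.
    have sI : -1 <= s <= 1 by rewrite (ltW s1).
    have as1 : acos s < pi by apply: acos_ltpi; rewrite s1.
    have d0 : 0 < pi - acos s by rewrite subr_gt0.
    have [n ln] : exists n : nat, (pi - t) / (pi - acos s) <= n%:R.
      exists (Num.bound ((pi - t) / (pi - acos s))).
      by apply/ltW/archi_boundP; rewrite divr_ge0 ?ltW ?subr_gt0.
    exists n => //=; rewrite in_itv/= st andbT.
    rewrite -[leRHS]acosK ?in_itv//=.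
    rewrite ler_cos//; last by rewrite in_itv/= acos_ge0// ltW.
    have : (pi - t) / n.+2%:R <= pi - acos s.
      rewrite ler_pdivrMr// mulrC -ler_pdivrMr// (le_trans ln)// ler_nat.
      by rewrite -addn2 leq_addr.
    by rewrite /a; move: (_ / n.+2%:R) => d; lra.
  move=> [n _ /=]; rewrite in_itv/= => /andP[s1 ->]; rewrite andbT.
  apply: lt_le_trans s1; have := @cos_bound_oo R (a n).
  by have := aI n => H1 H2; have /andP[] : -1 < cos (a n) < 1 by apply: H2; lra.
have mF n : measurable (F n) by exact: measurable_itv.
have := @ge0_nondecreasing_set_cvg_integral _ (measurableTypeR R) R F (EFin \o acos_integrand) mu.
rewrite -FE => H; apply: cvg_unique (H _ mF _ _) _ => //.
- move=> n m nm; apply/subsetPset; apply: subset_itvr; rewrite bnd_simp.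
  rewrite ler_cos// /a lerB// ler_wpM2l//; first by lra.
  by rewrite lef_pV2 ?posrE// ler_nat !ltnS.
- move=> n; apply/measurable_EFinP.
  apply: measurable_funS measurable_acos_integrand => //.
  by rewrite FE; exact: bigcup_sup.
- move=> n s; rewrite /F/= in_itv/= => /andP[s1 st].
  rewrite lee_fin mulr_ge0 ?invr_ge0 ?sqrtr_ge0// psi_ge0//.
  have an := aI n; have /andP[ca _] : -1 < cos (a n) < 1 by apply: cos_bound_oo; lra.
  have s1' : s <= 1 by rewrite (le_trans st)// cos_le1.
  have sI : -1 <= s <= 1 by rewrite s1' andbT (le_trans _ s1)// ltW.
  rewrite in_itv/= acos_lepi// andbT leNgt; apply/negP => ast.
  have : cos t < cos (acos s).
    by rewrite ltr_cos// in_itv/= ?acos_ge0 ?acos_lepi// !ltW.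
  by rewrite acosK ?in_itv// ltNge st.
- rewrite /=; have -> : (fun n => \int[mu]_(s in F n) (acos_integrand s)%:E)%E =
      (fun n => (Psi t - Psi (a n))%:E).
    by apply/funext => n; exact: acos_integrand_FTC.
  apply: cvg_EFin; first by near=> n.
  apply: cvgB; first exact: cvg_cst.
  have a_cvg : a n @[n --> \oo] --> (pi - (pi - t) * 0 : R).
    apply: cvgB; first exact: cvg_cst.
    apply: cvgM; first exact: cvg_cst.
    by have := @cvg_harmonic R; rewrite -cvg_shiftS.
  rewrite mulr0 subr0 in a_cvg.
  by apply: cvg_comp a_cvg _; exact: is_derive_continuous (dPsi pi).
Unshelve. all: by end_near. Qed.

End cos_substitution.

(** * Closed form of the Chebyshev coefficients *)

Section chebyshev_coefficients.
Context {R : realType}.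
Implicit Types (t u s b : R) (k : nat).
Notation mu := (@lebesgue_measure R).

Lemma chebyshevT_cos k u : (chebyshevT k).[cos u] = cos (k%:R * u).
Proof.
suff [] : (chebyshevT k).[cos u] = cos (k%:R * u) /\
  (chebyshevT k.+1).[cos u] = cos (k.+1%:R * u) by [].
elim: k => [|k [IH0 IH1]].
  by split; rewrite /= ?hornerE ?mul0r ?cos0// mul1r.
split => //; have -> : chebyshevT k.+2 =
  2%:R *: ('X * chebyshevT k.+1) - chebyshevT k :> {poly R} by [].
rewrite hornerD hornerN hornerZ hornerM hornerX IH0 IH1.
have -> : k.+2%:R * u = k.+1%:R * u + u by rewrite -[k.+2%:R]natr1; ring.
have -> : k%:R * u = k.+1%:R * u - u by rewrite -natr1; ring.
by rewrite cosB cosD; ring.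
Qed.

Lemma chebyshevT_bound k s : -1 <= s <= 1 -> `|(chebyshevT k).[s]| <= 1.
Proof.
by move=> sI; rewrite -(@acosK R s) ?in_itv// chebyshevT_cos cos_max.
Qed.

(** For [psi] of varying sign, write [psi = (psi0 + psi) - psi0]: by domination both parts are
    nonnegative on [[t, pi]]. *)
Lemma Rintegral_acos (Psi psi Psi0 psi0 : R -> R) t : 0 < t < pi ->
  (forall u, is_derive u 1 Psi (- psi u)) -> continuous psi ->
  (forall u, is_derive u 1 Psi0 (- psi0 u)) -> continuous psi0 ->
  (forall u, u \in `[t, pi] -> `|psi u| <= psi0 u) ->
  mu.-integrable `](-1)%R, cos t] (EFin \o acos_integrand psi) /\
  \int[mu]_(s in `](-1)%R, cos t]) acos_integrand psi s = Psi t - Psi pi.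
Proof.
move=> tI dPsi cpsi dPsi0 cpsi0 psi_le.
have ge0_int (Q q : R -> R) : (forall u, is_derive u 1 Q (- q u)) -> continuous q ->
    (forall u, u \in `[t, pi] -> 0 <= q u) ->
    mu.-integrable `](-1)%R, cos t] (EFin \o acos_integrand q) /\
    \int[mu]_(s in `](-1)%R, cos t]) acos_integrand q s = Q t - Q pi.
  move=> dQ cq q0.
  have E := ge0_integral_acos tI dQ cq q0; split; last by rewrite /Rintegral E.
  apply/integrableP; split.
    by apply/measurable_EFinP; exact: measurable_acos_integrand.
  rewrite (integral_fin_num_abs mu)//; first by rewrite E.
  exact: measurable_acos_integrand.
pose psi1 u := psi0 u + psi u.
have dPsi1 u : is_derive u 1 (Psi0 \+ Psi) (- psi1 u).
  by have ? := dPsi u; have ? := dPsi0 u; apply: is_derive_eq; rewrite /psi1; ring.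
have cpsi1 : continuous psi1 by move=> u; apply: cvgD; [exact: cpsi0|exact: cpsi].
have psi0_ge0 u : u \in `[t, pi] -> 0 <= psi0 u.
  by move=> /psi_le; apply: le_trans.
have psi1_ge0 u : u \in `[t, pi] -> 0 <= psi1 u.
  by move=> /psi_le; rewrite /psi1 ler_norml => /andP[]; lra.
have [int0 E0] := ge0_int _ _ dPsi0 cpsi0 psi0_ge0.
have [int1 E1] := ge0_int _ _ dPsi1 cpsi1 psi1_ge0.
have -> : acos_integrand psi = (fun s => acos_integrand psi1 s - acos_integrand psi0 s).
  by apply/funext => s; rewrite /acos_integrand /psi1; ring.
split; last by rewrite RintegralB// E0 E1/=; ring.
rewrite (_ : EFin \o _ = (EFin \o acos_integrand psi1) \- (EFin \o acos_integrand psi0))%E//.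
exact: integrableB.
Qed.

Lemma kcoef_primitive t k : exists2 Psi : R -> R,
  forall u, is_derive u 1 Psi (- ((cos t - cos u) * cos (k%:R * u))) &
  2 / pi * (Psi t - Psi pi) = kcoef t k.
Proof.
have pi_neq0 : pi != 0 :> R by rewrite gt_eqF// pi_gt0.
have [k1|] := leqP k 1; last first.
  move=> k1; have [n0 n1 n2] := @natr_shift_neq0 R k k1.
  exists (fun u => sin ((k%:R + 1) * u) / (2 * (k%:R + 1)) +
                   sin ((k%:R - 1) * u) / (2 * (k%:R - 1)) -
                   cos t * (sin (k%:R * u) / k%:R)).
    move=> u; apply: is_derive_eq; rewrite /GRing.scale/=.
    have -> : (k%:R - 1) * u = k%:R * u - u by ring.
    have -> : (k%:R + 1) * u = k%:R * u + u by ring.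
    by rewrite cosB cosD; field; rewrite n0 n1 n2.
  have -> : (k%:R - 1) * pi = k.-1%:R * pi :> R by rewrite -subn1 natrB// ltnW.
  have -> : (k%:R + 1) * pi = k.+1%:R * pi :> R by rewrite -natr1.
  have -> : kcoef t k = (pi * k%:R)^-1 *
    (sin ((k%:R - 1) * t) / (k%:R - 1) - sin ((k%:R + 1) * t) / (k%:R + 1)).
    by case: k k1 {n0 n1 n2} => [|[]].
  rewrite !sin_natpi.
  have -> : (k%:R - 1) * t = k%:R * t - t by ring.
  have -> : (k%:R + 1) * t = k%:R * t + t by ring.
  rewrite sinB sinD; move: (pi : R) pi_neq0 => p p0.
  by field; rewrite p0 n0 n1 n2.
case: k k1 => [|[|//]] _; rewrite /kcoef.
  exists (fun u => sin u - u * cos t).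
    move=> u; apply: is_derive_eq; rewrite /GRing.scale/= mul0r cos0; ring.
  by rewrite sinpi; ring.
exists (fun u => u / 2 + sin (2 * u) / 4 - cos t * sin u).
  move=> u; apply: is_derive_eq; rewrite /GRing.scale/= mul1r.
  rewrite (_ : 2 * u = u *+ 2) ?cos_mulr2n; last by rewrite mulr2n; lra.
  by field.
rewrite sinpi (sin_natpi 2) (_ : 2 * t = t *+ 2) ?sin_mulr2n; last by rewrite mulr2n; lra.
by move: (pi : R) pi_neq0 => p p0; field.
Qed.

(** For [1 < b], the angle [u] at which [b / 2 * (cos u + 1)] takes the value [1], where [pospart1B]
    has its kink. *)
Definition kink_angle b := acos (2 / b - 1).

Lemma kink_angle_arg_in b : 1 < b -> -1 < 2 / b - 1 < 1.
Proof.
move=> b1; have b0 : 0 < b by rewrite (lt_trans _ b1).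
have : 0 < 2 / b by rewrite divr_gt0.
have : 2 / b < 2 by rewrite ltr_pdivrMr// ltr_pMr.
by move: (2 / b) => c; lra.
Qed.

Lemma cos_kink_angle b : 1 < b -> cos (kink_angle b) = 2 / b - 1.
Proof.
move=> /kink_angle_arg_in /andP[b1 b2].
by rewrite /kink_angle acosK// in_itv/= !ltW.
Qed.

Lemma kink_angle_in b : 1 < b -> 0 < kink_angle b < pi.
Proof.
move=> /kink_angle_arg_in /andP[b1 b2].
by rewrite acos_gt0 ?acos_ltpi// ?b1 ?b2 ltW.
Qed.

Lemma pospart1B_cos b u : 1 < b ->
  pospart1B (b / 2 * (cos u + 1)) = b / 2 * kink (kink_angle b) u.
Proof.
move=> b1; have b0 : 0 < b by rewrite (lt_trans _ b1).
rewrite /pospart1B /kink cos_kink_angle// maxr_pMr ?divr_ge0 ?ltW// mulr0.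
by congr Num.max; field; rewrite gt_eqF.
Qed.

Lemma cheb_coefE b k : 1 < b -> cheb_coef b k = b / 2 * kcoef (kink_angle b) k.
Proof.
move=> b1; have b0 : 0 < b by rewrite (lt_trans _ b1).
set t := kink_angle b; have tI : 0 < t < pi := kink_angle_in b1.
case/andP: (tI) => t0 tpi.
have [Psi dPsi EPsi] := kcoef_primitive t k.
have [Psi0 dPsi0 _] := kcoef_primitive t 0.
pose psi j u := (cos t - cos u) * cos (j%:R * u).
have cpsi j : continuous (psi j).
  move=> u; apply: cvgM; first by apply: cvgB; [exact: cvg_cst|exact: continuous_cos].
  apply: (@continuous_comp _ _ _ (fun u => j%:R * u) (@cos R)); last exact: continuous_cos.
  by apply: cvgM; [exact: cvg_cst|exact: cvg_id].
(* The integrand of the coefficient [0] is nonnegative and dominates all the others. *)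
have psi_le u : u \in `[t, pi] -> `|psi k u| <= psi 0 u.
  rewrite in_itv/= => /andP[tu upi].
  have c0 : 0 <= cos t - cos u by rewrite subr_ge0 ler_cos// in_itv/=; lra.
  by rewrite /psi normrM mul0r cos0 mulr1 (ger0_norm c0) ler_piMr ?cos_max.
have [psi_int psiE] := Rintegral_acos tI dPsi (cpsi k) dPsi0 (cpsi 0) psi_le.
rewrite -EPsi -psiE /cheb_coef mulrCA; congr (_ * _).
rewrite -RintegralZl// [LHS]Rintegral_mkcond [RHS]Rintegral_mkcond.
congr (Rintegral _ _ _); apply/funext => s; rewrite !patchE.
have [/andP[ct ct1]] := kink_angle_arg_in b1.
have ctE : cos t = 2 / b - 1 := cos_kink_angle b1.
rewrite -ctE in ct ct1.
have main : -1 < s <= 1 ->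
  pospart1B (b / 2 * (s + 1)) * (chebyshevT k).[s] / Num.sqrt (1 - s ^+ 2) =
  b / 2 * (Num.max 0 (cos t - s) * cos (k%:R * acos s) / Num.sqrt (1 - s ^+ 2)).
  move=> /andP[s1 s2].
  have sE : s = cos (acos s) by rewrite acosK// in_itv/= s2 ltW.
  rewrite {1 2}sE pospart1B_cos// chebyshevT_cos /kink -sE -/t; ring.
case: ifPn; rewrite ?inE/= ?notin_setE/= in_itv/=; last first.
  move=> sI; case: ifPn => //; rewrite inE/= in_itv/= => /andP[s1 s2].
  by exfalso; apply: sI; rewrite ltW// (le_trans s2)// ltW.
(* At [s = -1] the integrand is [0] by the convention on [0^-1], so the patched functions agree
   there too; beyond [cos t] the positive part vanishes. *)
rewrite le_eqVlt => /andP[/predU1P[<-|s1] s2].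
  rewrite memNset/= ?in_itv/= ?ltxx//.
  by rewrite sqrrN expr1n subrr sqrtr0 invr0 mulr0.
rewrite main ?s1//; case: ifPn; rewrite ?inE/= ?notin_setE/= in_itv/= s1/=.
  move=> st; rewrite max_r ?subr_ge0//.
  by rewrite /acos_integrand /psi acosK// in_itv/= s2 ltW.
by move=> /negP; rewrite -ltNge => st; rewrite max_l ?subr_le0 1?ltW// !mul0r mulr0.
Qed.

End chebyshev_coefficients.

(** * The uniform error *)

Section chebyshev_error.
Context {R : realType}.
Implicit Types (t u s x b : R) (k r : nat).

Let pi0 : 0 < pi :> R := pi_gt0 R.

Section fixed_bound.
Variable b : R.
Hypothesis b1 : 1 < b.
Let b0 : 0 < b. Proof. exact: lt_trans b1. Qed.
Let t := kink_angle b.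
Let tI : 0 < t < pi. Proof. exact: kink_angle_in. Qed.

Lemma cheb_trunc_cos r u :
  cheb_trunc b r (b / 2 * (cos u + 1)) = b / 2 * ksum r t u.
Proof.
rewrite /cheb_trunc /ksum cheb_coefE// -/t [RHS]mulrDr mulr_sumr; congr (_ + _).
  by ring.
apply: eq_bigr => k _; rewrite cheb_coefE// -/t -mulrA; congr (_ * (_ * _)).
rewrite (_ : 2 * _ / b - 1 = cos u) ?chebyshevT_cos//.
by field; rewrite gt_eqF.
Qed.

Lemma cheb_err_cos r u :
  `|pospart1B (b / 2 * (cos u + 1)) - cheb_trunc b r (b / 2 * (cos u + 1))| =
  b / 2 * `|kink t u - ksum r t u|.
Proof.
rewrite pospart1B_cos// cheb_trunc_cos -mulrBr normrM ger0_norm//.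
by rewrite divr_ge0// ltW.
Qed.

Lemma cos_param x : 0 <= x <= b ->
  exists2 u, 0 <= u <= pi & x = b / 2 * (cos u + 1).
Proof.
move=> /andP[x0 xb].
have sI : -1 <= 2 * x / b - 1 <= 1.
  have : 0 <= 2 * x / b by rewrite !mulr_ge0// invr_ge0 ltW.
  have : 2 * x / b <= 2 by rewrite ler_pdivrMr// ler_pM2l.
  by move: (2 * x / b) => y; lra.
exists (acos (2 * x / b - 1)); first by rewrite acos_ge0 ?acos_lepi.
by rewrite acosK ?in_itv//; field; rewrite gt_eqF.
Qed.

Lemma cos_param_in u : 0 <= b / 2 * (cos u + 1) <= b.
Proof.
have := cos_geN1 u; have := cos_le1 u => c1 cN1.
have h0 : 0 <= b / 2 by rewrite divr_ge0// ltW.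
have : b / 2 * (cos u + 1) <= b / 2 * 2 by rewrite ler_wpM2l//; lra.
have c0 : 0 <= cos u + 1 by lra.
by rewrite mulr_ge0//= divfK.
Qed.

Lemma cheb_err_le r (M : R) :
  (forall u, 0 <= u <= pi -> `|kink t u - ksum r t u| <= M) ->
  cheb_err b r <= b / 2 * M.
Proof.
move=> HM; apply: ge_sup.
  exists (`|pospart1B 0 - cheb_trunc b r 0|), 0 => //=.
  by rewrite in_itv/= lexx ltW.
move=> _ [x /= + <-]; rewrite in_itv/= => /cos_param[u uI ->].
by rewrite cheb_err_cos ler_pM2l ?divr_gt0// HM.
Qed.

(** Boundedness is what makes the [sup] in [cheb_err] a true upper bound; a crude triangle
    inequality suffices. *)
Lemma has_ubound_cheb_err r :
  has_ubound [set `|pospart1B x - cheb_trunc b r x| | x in `[0, b]].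
Proof.
exists (b / 2 * (2 + (`|kcoef t 0 / 2| + \sum_(1 <= k < r.+1) `|kcoef t k|))).
move=> _ [x /= + <-]; rewrite in_itv/= => /cos_param[u uI ->].
rewrite cheb_err_cos ler_pM2l ?divr_gt0//.
apply: le_trans (ler_normB _ _) _; apply: lerD.
  rewrite /kink; have := cos_geN1 t; have := cos_le1 t.
  have := cos_geN1 u; have := cos_le1 u => *.
  by have [_|_] := leP 0 (cos t - cos u); rewrite ?normr0// ler_norml; lra.
apply: le_trans (ler_normD _ _) _; rewrite lerD2l.
apply: le_trans (ler_norm_sum _ _ _) _; apply: ler_sum => k _.
by rewrite normrM ler_piMr ?cos_max.
Qed.

Lemma le_cheb_err r x : 0 <= x <= b ->
  `|pospart1B x - cheb_trunc b r x| <= cheb_err b r.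
Proof.
by move=> xI; apply: ub_le_sup; [exact: has_ubound_cheb_err|exists x => //=; rewrite in_itv].
Qed.

Lemma cheb_err_ge0 r : 0 <= cheb_err b r.
Proof. by apply: le_trans (le_cheb_err r (cos_param_in 0)). Qed.

Lemma cheb_err_upper r : (0 < r)%N ->
  cheb_err b r <= b / 2 * (sin t / (pi * r%:R) + 2 / r%:R ^+ 2).
Proof. by move=> r0; apply: cheb_err_le => u uI; exact: kink_err_le. Qed.

Lemma cheb_err_lower r : (0 < r)%N ->
  b / 2 * (sin t / (pi * r.+1%:R) - 2 / r%:R ^+ 2) <= cheb_err b r.
Proof.
move=> r0; apply: le_trans (le_cheb_err r (cos_param_in t)).
by rewrite cheb_err_cos ler_pM2l ?divr_gt0//; exact: kink_err_ge.
Qed.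

(** Indeed [1 - (2 / b - 1)^2 = 4 (b - 1) / b^2]. *)
Lemma sin_kink_angle : b / 2 * sin t = Num.sqrt (b - 1).
Proof.
have /andP[c1 c2] := kink_angle_arg_in b1.
rewrite /t /kink_angle sin_acos ?ltW//.
have b20 : 0 <= b / 2 by rewrite divr_ge0// ltW.
rewrite -{1}(ger0_norm b20) -sqrtr_sqr -sqrtrM ?sqr_ge0//.
by congr Num.sqrt; field; rewrite gt_eqF.
Qed.

Lemma cheb_err_cvg : r%:R * cheb_err b r @[r --> \oo] --> Num.sqrt (b - 1) / pi.
Proof.
rewrite -sin_kink_angle.
have inv0 : (r.+1%:R^-1 : R) @[r --> \oo] --> (0 : R) by exact: cvg_harmonic.
(* The shift discards [r = 0], which the two bounds on the error exclude. *)
rewrite -cvg_shiftS/=.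
have upper : b / 2 * sin t / pi + b * r.+1%:R^-1 @[r --> \oo] --> b / 2 * sin t / pi.
  rewrite -[X in _ --> X]addr0 -[X in _ --> _ + X](mulr0 b).
  by apply: cvgD; [exact: cvg_cst|apply: cvgM inv0; exact: cvg_cst].
have lower : b / 2 * sin t / pi * (1 - r.+1%:R^-1) - b * r.+1%:R^-1 @[r --> \oo]
    --> b / 2 * sin t / pi * (1 - 0) - b * 0.
  apply: cvgB; last by apply: cvgM inv0; exact: cvg_cst.
  apply: cvgM; first exact: cvg_cst.
  by apply: cvgB inv0; exact: cvg_cst.
rewrite mulr0 !subr0 mulr1 in lower.
apply: squeeze_cvgr lower upper; near=> r.
have st0 : 0 <= sin t.
  by case/andP: tI => t0 tpi; apply: sin_ge0_pi; rewrite !ltW.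
have r0 : 0 < r.+1%:R :> R by [].
apply/andP; split; last first.
  apply: le_trans (ler_wpM2l (ltW r0) (cheb_err_upper (ltn0Sn r))) _.
  rewrite le_eqVlt; apply/orP; left; apply/eqP.
  by move: (pi : R) pi0 (r.+1%:R : R) r0 => p p0 ? ?; field; rewrite !gt_eqF.
apply: le_trans (ler_wpM2l (ltW r0) (cheb_err_lower (ltn0Sn r))).
have -> : r.+2%:R = r.+1%:R + 1 :> R by rewrite -[r.+2%:R]natr1.
move: (pi : R) pi0 (r.+1%:R : R) r0 => p p0 n n0.
have -> : n * (b / 2 * (sin t / (p * (n + 1)) - 2 / n ^+ 2)) =
  b / 2 * sin t / p * (1 - (n + 1)^-1) - b * n^-1.
  by field; rewrite !gt_eqF//; lra.
(* The exact factor is [n / (n + 1) = 1 - 1 / (n + 1)], weakened to [1 - 1 / n] so that one harmonic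
   sequence controls both bounds. *)
rewrite lerB// ler_wpM2l//; first by rewrite !mulr_ge0 ?invr_ge0// ltW.
by rewrite lerB// lef_pV2 ?posrE//; lra.
Unshelve. all: by end_near. Qed.

End fixed_bound.

End chebyshev_error.

(** * Volume of sublevel sets *)

Section scaling.
Context {R : realType}.
Notation mu := (@lebesgue_measure R).
Notation vol n := (@lebesgue_tuple R n).

Let measurable_mull (s : R) :
  measurable_fun [set: measurableTypeR R] (( *%R s) : measurableTypeR R -> measurableTypeR R).
Proof. by apply: measurable_funM => //; exact: measurable_cst. Qed.

(** Uniqueness of Lebesgue measure: the right-hand side is a measure in [A] with the same values on
    half-open intervals. *)
Lemma lebesgue_measure_scale (s : R) (A : set (measurableTypeR R)) : 0 < s ->
  measurable A -> mu A = (s%:E * mu ( *%R s @^-1` A))%E.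
Proof.
move=> s0 mA.
pose m' : {measure set (measurableTypeR R) -> \bar R} :=
  mscale (NngNum (ltW s0))
    (measure_function_pushforward__canonical__measure_function_Measure
      mu (measurable_mull s)).
apply: (@lebesgue_measure_unique R m') => // _ [[a b] _ <-].
rewrite /m' /= /mscale /= /pushforward.
rewrite (_ : _ @^-1` _ = [set` `]a / s, b / s]%R]); last first.
  apply/seteqP; split => x /=; rewrite !in_itv/= ltr_pdivrMr// ler_pdivlMr//;
    by rewrite mulrC.
rewrite !lebesgue_measure_itv/= !lte_fin ltr_pM2r ?invr_gt0//.
case: ifPn => _; last by rewrite mule0.
by rewrite -!EFinB -EFinM -mulrBl mulrCA divff ?mulr1// gt_eqF.
Qed.

Definition dilate n (s : 'I_n -> R) (x : euclid R n) : euclid R n :=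
  [tuple s i * tnth x i | i < n].

Lemma measurable_dilate n (s : 'I_n -> R) :
  measurable_fun [set: euclid R n] (dilate s).
Proof.
apply/measurable_fun_tnthP => i.
rewrite (_ : _ \o _ = ( *%R (s i)) \o (fun x : euclid R n => tnth x i)); last first.
  by apply/funext => x /=; rewrite tnth_mktuple.
by apply: measurableT_comp; [exact: measurable_mull|exact: measurable_tnth].
Qed.

Lemma dilate_tcons n (s : 'I_n.+1 -> R) (a : R) (x : euclid R n) :
  dilate s (tcons (a, x)) = tcons (s ord0 * a, dilate (fun i => s (lift ord0 i)) x).
Proof.
apply: eq_from_tnth => i; rewrite tnth_mktuple; case: (unliftP ord0 i) => [j ->|->].
  by rewrite !tnthS tnth_mktuple.
by rewrite !tnth0.
Qed.

(** Induction on the dimension: after splitting off the first coordinate, the rescaled image measure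
    agrees with the product measure on rectangles, hence everywhere. *)
Lemma lebesgue_tuple_dilate n (s : 'I_n -> R) (A : set (euclid R n)) :
  (forall i, 0 < s i) -> measurable A ->
  vol n A = ((\prod_(i < n) s i)%:E * vol n (dilate s @^-1` A))%E.
Proof.
elim: n s A => [|n IH] s A s0 mA.
  rewrite big_ord0 mul1e /=; congr (dirac _ _); apply/seteqP.
  by split => x /=; rewrite (tuple0 x) (tuple0 (dilate _ _)).
have p0 : 0 <= \prod_(i < n.+1) s i by apply: prodr_ge0 => i _; exact: ltW.
pose s' i := s (lift ord0 i).
pose D (z : measurableTypeR R * euclid R n) : measurableTypeR R * euclid R n :=
  (s ord0 * z.1, dilate s' z.2).
have mD : measurable_fun [set: measurableTypeR R * euclid R n] D.
  apply/measurable_fun_pairP; split.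
    rewrite (_ : _ \o _ = ( *%R (s ord0)) \o (@fst (measurableTypeR R) (euclid R n)))//.
    by apply: measurableT_comp => //; exact: measurable_mull.
  rewrite (_ : _ \o _ = (dilate s') \o (@snd (measurableTypeR R) (euclid R n)))//.
  by apply: measurableT_comp => //; exact: measurable_dilate.
pose m' : {measure set (measurableTypeR R * euclid R n)%type -> \bar R} :=
  mscale (NngNum p0)
    (measure_function_pushforward__canonical__measure_function_Measure
      (mu \x vol n)%E mD).
rewrite /= /lebesgue_tuple_step /pushforward.
have mA' : measurable (@tcons R n @^-1` A).
  by rewrite -[X in measurable X]setTI; exact: measurable_tcons.
rewrite (@product_measure_unique _ _ _ _ _ mu (vol n) m' _ _ mA').
  rewrite /m' /= /mscale /= /pushforward; congr (_ * (_ \x _)%E _)%E.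
  by apply/seteqP; split => -[a x] /=; rewrite dilate_tcons.
move=> B C mB mC; rewrite /m' /= /mscale /= /pushforward.
have -> : D @^-1` (B `*` C) = ( *%R (s ord0) @^-1` B) `*` (dilate s' @^-1` C) by [].
rewrite product_measure1E; last 2 first.
- by rewrite -[X in measurable X]setTI; exact: measurable_mull.
- by rewrite -[X in measurable X]setTI; exact: measurable_dilate.
rewrite (lebesgue_measure_scale (s0 ord0) mB) (IH s' C (fun i => s0 (lift ord0 i)) mC).
by rewrite big_ord_recl EFinM muleACA.
Qed.

End scaling.

(** * Scaling law for the volumes of sublevel sets *)

Section quasi_homogeneous_volume.
Context {R : realType}.
Variables (n m : nat) (w : 'I_n -> nat) (g : mpoly.mpoly n R).
Notation mu := (@lebesgue_measure R).
Notation vol := (@lebesgue_tuple R n).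

Lemma measurable_peval : measurable_fun [set: euclid R n] (peval g).
Proof.
rewrite (_ : peval g = fun x => \sum_(k <- mpoly.msupp g)
    mpoly.mcoeff k g * \prod_i tnth x i ^+ mpoly.fun_of_multinom k i); last first.
  by apply/funext => x; exact: mpoly.mevalE.
apply: measurable_sum => k; apply: measurable_funM; first exact: measurable_cst.
apply: measurable_prod => i _; apply: measurable_funX; exact: measurable_tnth.
Qed.

Lemma measurable_sublevel u : measurable [set x | peval g x <= u].
Proof.
rewrite -[X in measurable X]setTI; apply: measurable_fun_le => //.
exact: measurable_peval.
Qed.

Hypothesis g_qh : quasi_homogeneous w m g.

(** The dilation with factors [t ^+ w i] has determinant [t ^+ wnorm w] and, by quasi-homogeneity,
    pulls the set [g <= t ^+ m] back to [g <= 1]. *)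
Lemma vol_sublevel_pow (t : R) : 0 < t ->
  vol [set x | peval g x <= t ^+ m] = ((t ^+ wnorm w)%:E * vol (sublevel1 g))%E.
Proof.
move=> t0.
rewrite (@lebesgue_tuple_dilate _ _ (fun i => t ^+ w i)); last exact: measurable_sublevel.
  congr (_%:E * vol _)%E; first by rewrite /wnorm prodrXr.
  apply/seteqP; split => x /=; by rewrite /sublevel1/= g_qh// ger_pMr// exprn_gt0.
by move=> i; rewrite exprn_gt0.
Qed.

Hypothesis m0 : (0 < m)%N.

Lemma vol_sublevel (u : R) : 0 < u ->
  vol [set x | peval g x <= u] =
  ((u `^ ((wnorm w)%:R / m%:R))%:E * vol (sublevel1 g))%E.
Proof.
move=> u0.
have m0' : m%:R != 0 :> R by rewrite pnatr_eq0 -lt0n.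
have := @vol_sublevel_pow (u `^ m%:R^-1) (powR_gt0 _ u0).
rewrite -!powR_mulrn ?powR_ge0// -!powRrM mulVf// powRr1 ?ltW// => ->.
by rewrite mulrC.
Qed.

End quasi_homogeneous_volume.

(** * The integral of the positive part of [1 - g] *)

Section sublevel_integral.
Context {R : realType}.
Notation mu := (@lebesgue_measure R).

Lemma integral_powR (a : R) : 0 < a ->
  (\int[mu]_(u in `[0%R, 1%R]) (u `^ a)%:E = ((a + 1)^-1)%:E)%E.
Proof.
move=> a0; have a1 : 0 < a + 1 by rewrite addr_gt0.
have cp (c : R) : 0 < c -> {within `[0, 1], continuous (@powR R ^~ c)}.
  move=> c0; apply/(continuous_within_itvP _ ltr01); split.
  - move=> x; rewrite in_itv/= => /andP[x0 _].
    by apply: is_derive_continuous (is_derive1_powR c x0).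
  - by rewrite powR0 ?gt_eqF//; exact: powR_cvg0.
  - apply: cvg_at_left_filter.
    by apply: is_derive_continuous (is_derive1_powR c ltr01).
rewrite (@continuous_FTC2 _ _ (fun u => (a + 1)^-1 * u `^ (a + 1)) _ _ ltr01).
- by rewrite powR1 mulr1 powR0 ?gt_eqF// mulr0 sube0.
- exact: cp.
- have /(continuous_within_itvP _ ltr01)[c1 c2 c3] := cp _ a1; split.
  + move=> x; rewrite in_itv/= => /andP[x0 _].
    have ? := is_derive1_powR (a + 1) x0.
    by apply: derivableM => //; exact: ex_derive.
  + by apply: cvgM; [exact: cvg_cst|exact: c2].
  + by apply: cvgM; [exact: cvg_cst|exact: c3].
- move=> x; rewrite in_itv/= => /andP[x0 _].
  have ? := is_derive1_powR (a + 1) x0.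
  rewrite derive1E; apply: derive_val.
  apply: is_derive_eq; rewrite /GRing.scale/= addrK; field.
  by rewrite gt_eqF.
Qed.

Variables (n m : nat) (w : 'I_n -> nat) (g : mpoly.mpoly n R).
Notation vol := (@lebesgue_tuple R n).
Hypothesis g_qh : quasi_homogeneous w m g.
Hypothesis m0 : (0 < m)%N.
Hypothesis w0 : (0 < wnorm w)%N.
Hypothesis g_ge0 : forall x : euclid R n, 0 <= peval g x.

(* Tonelli on [{(u, x) | g x <= u <= 1}]. *)
Lemma integral_pospart1B_peval :
  (\int[vol]_x (pospart1B (peval g x))%:E =
   (m%:R / (wnorm w + m)%:R)%:E * vol (sublevel1 g))%E.
Proof.
pose A : set (measurableTypeR R * euclid R n) :=
  [set z | peval g z.2 <= z.1] `&` [set z | z.1 <= 1].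
have mA : measurable A.
  apply: measurableI; rewrite -[X in measurable X]setTI; apply: measurable_fun_le => //.
  by apply: (measurableT_comp (measurable_peval g)).
have := @indic_fubini_tonelli _ _ _ _ R mu vol _ mA.
have mF := @indic_measurable_fun_fubini_tonelli_F _ _ _ _ R vol _ mA.
rewrite indic_fubini_tonelli_FE// in mF.
rewrite indic_fubini_tonelli_FE// indic_fubini_tonelli_GE//.
(* For fixed [x] the section is the interval from [g x] to [1], whose length is the positive part of
   [1 - g x]. *)
have -> : (\int[vol]_y (mu \o ysection A) y = \int[vol]_x (pospart1B (peval g x))%:E)%E.
  apply: eq_integral => x _ /=.
  have -> : ysection A x = [set` `[peval g x, 1]%R].
    apply/seteqP; rewrite ysectionE /A; split => u /=; rewrite in_itv/=.
      by move=> [-> ->].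
    by move=> /andP[].
  rewrite lebesgue_measure_itv/= lte_fin /pospart1B.
  have [g1|g1] := ltP (peval g x) 1.
    by rewrite max_r ?subr_ge0 ?ltW// EFinB.
  by rewrite max_l ?subr_le0.
move=> <-.
have sE u : 0 < u <= 1 -> vol (xsection A u) =
    ((u `^ ((wnorm w)%:R / m%:R))%:E * vol (sublevel1 g))%E.
  move=> /andP[u0 u1]; rewrite -vol_sublevel//; congr (vol _).
  apply/seteqP; rewrite xsectionE /A; split => x /=; first by case.
  by move=> ?; split.
have a0 : 0 < (wnorm w)%:R / m%:R :> R by rewrite divr_gt0// ltr0n.
(* The sections are empty for [u > 1] by construction and for [u < 0] because [g >= 0]. The endpoint
   [0], not covered by [vol_sublevel], is a null set and is dropped next. *)
transitivity (\int[mu]_(u in `[0%R, 1%R]) (vol \o xsection A) u)%E.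
  rewrite [RHS]integral_mkcond; apply: eq_integral => u _.
  rewrite patchE; case: ifPn => //; rewrite notin_setE/= in_itv/= => /negP uI /=.
  rewrite (_ : xsection A u = set0) ?measure0//.
  apply/seteqP; rewrite xsectionE /A; split => x //= -[gu u1].
  by move: uI; rewrite u1 (le_trans _ gu).
rewrite -integral_itv_obnd_cbnd; last exact: measurable_funTS.
pose p (u : measurableTypeR R) : \bar R := (u `^ ((wnorm w)%:R / m%:R))%:E.
have mp (D : set (measurableTypeR R)) : measurable_fun D p.
  by apply/measurable_EFinP; apply: measurable_funTS; exact: measurable_powR.
transitivity (\int[mu]_(u in `]0%R, 1%R]) (p u * vol (sublevel1 g)))%E.
  by apply: eq_integral => u; rewrite inE/= in_itv/= => /sE.
rewrite (ge0_integralZr _ _ (mp _))//; last first.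
  by move=> u _; rewrite lee_fin powR_ge0.
rewrite (integral_itv_obnd_cbnd (mp _)) integral_powR//.
congr (_%:E * _)%E; rewrite natrD; field.
by rewrite -natrD !pnatr_eq0 addn_eq0 -!lt0n m0 (gtn_eqF m0) andbF.
Qed.

End sublevel_integral.

(** * The bracket *)

Section cube_uniform_integrals.
Context {R : realType}.
Variables (n m : nat) (w : 'I_n -> nat) (g : mpoly.mpoly n R) (b : R).
Notation vol := (@lebesgue_tuple R n).
Notation P := (@cube_uniform R n).
Hypothesis g_qh : quasi_homogeneous w m g.
Hypothesis m0 : (0 < m)%N.
Hypothesis w0 : (0 < wnorm w)%N.
Hypothesis g_ge0 : forall x : euclid R n, 0 <= peval g x.
Hypothesis K_sub_B : sublevel1 g `<=` cube R n.
Hypothesis g_le : forall x, cube R n x -> peval g x <= b.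
Hypothesis b1 : 1 < b.

Let mcube : measurable (cube R n) := @measurable_cube R n.

Let b0 : 0 < b. Proof. exact: lt_trans b1. Qed.

Lemma cube_uniform_cube : P (cube R n) = 1%E.
Proof.
by rewrite -(cube_uniform_setT n) /cube_uniform /= /mscale /= /mrestr setIid setTI.
Qed.

Lemma Rintegral_cube_cst (c : R) : \int[P]_(x in cube R n) c = c.
Proof. by rewrite Rintegral_cst// cube_uniform_cube mulr1. Qed.

Lemma bounded_cube_integrable (f : euclid R n -> R) (M : R) :
  measurable_fun [set: euclid R n] f ->
  (forall x, cube R n x -> `|f x| <= M) ->
  P.-integrable (cube R n) (EFin \o f).
Proof.
move=> mf fM; apply: measurable_bounded_integrable => //.
- by rewrite cube_uniform_cube ltry.
- exact: measurable_funTS.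
- exists M; split; first exact: num_real.
  by move=> N MN x /fM fx; exact: le_trans fx (ltW MN).
Qed.

Lemma measurable_cheb k :
  measurable_fun [set: euclid R n] (fun x => (chebyshevT k).[2 * peval g x / b - 1]).
Proof.
apply: (@measurableT_comp _ _ _ _ _ _ (fun s : R => (chebyshevT k).[s])).
  exact: measurable_poly.
apply: measurable_funB; last exact: measurable_cst.
apply: measurable_funM; last exact: measurable_cst.
apply: measurable_funM; first exact: measurable_cst.
exact: measurable_peval.
Qed.

Lemma cheb_integrable k :
  P.-integrable (cube R n) (EFin \o (fun x => (chebyshevT k).[2 * peval g x / b - 1])).
Proof.
apply: (@bounded_cube_integrable _ 1); first exact: measurable_cheb.
move=> x xB; apply: chebyshevT_bound.
have : 2 * peval g x / b <= 2 by rewrite ler_pdivrMr// ler_pM2l// g_le.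
have : 0 <= 2 * peval g x / b by rewrite !mulr_ge0// invr_ge0 ltW.
by move: (_ / b) => y; lra.
Qed.

Lemma cheb_trunc_peval_integral r :
  P.-integrable (cube R n) (EFin \o (fun x => cheb_trunc b r (peval g x))) /\
  \int[P]_(x in cube R n) cheb_trunc b r (peval g x) =
  cheb_coef b 0 / 2 + \sum_(1 <= k < r.+1) cheb_coef b k * cheb_moment g b k.
Proof.
elim: r => [|r [IH1 IH2]].
  split.
    apply: (@bounded_cube_integrable _ `|cheb_coef b 0 / 2|).
      rewrite (_ : (fun _ => _) = cst (cheb_coef b 0 / 2)); first exact: measurable_cst.
      by apply/funext => x; rewrite /cheb_trunc big_geq// addr0.
    by move=> x _; rewrite /cheb_trunc big_geq// addr0.
  rewrite big_geq// addr0 -[RHS]Rintegral_cube_cst.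
  by apply: eq_Rintegral => x _; rewrite /cheb_trunc big_geq// addr0.
have E x : cheb_trunc b r.+1 (peval g x) = cheb_trunc b r (peval g x) +
    cheb_coef b r.+1 * (chebyshevT r.+1).[2 * peval g x / b - 1].
  by rewrite /cheb_trunc big_nat_recr//= addrA.
have int2 : P.-integrable (cube R n) (EFin \o (fun x => cheb_coef b r.+1 *
    (chebyshevT r.+1).[2 * peval g x / b - 1])).
  rewrite (_ : EFin \o _ = (fun x => (cheb_coef b r.+1)%:E *
    (EFin \o (fun x => (chebyshevT r.+1).[2 * peval g x / b - 1])) x)%E)//.
  by apply: integrableZl => //; exact: cheb_integrable.
split.
  rewrite (_ : EFin \o _ = (EFin \o (fun x => cheb_trunc b r (peval g x))) \+
    (EFin \o (fun x => cheb_coef b r.+1 * (chebyshevT r.+1).[2 * peval g x / b - 1])%R))%E.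
    exact: integrableD.
  by apply/funext => x /=; rewrite E EFinD.
rewrite big_nat_recr//= addrA -IH2 /cheb_moment -RintegralZl//; last exact: cheb_integrable.
by rewrite -RintegralD//; apply: eq_Rintegral => x _; rewrite E.
Qed.

Lemma measurable_pospart1B_peval :
  measurable_fun [set: euclid R n] (fun x => pospart1B (peval g x)).
Proof.
apply: measurable_maxr; first exact: measurable_cst.
by apply: measurable_funB; [exact: measurable_cst|exact: measurable_peval].
Qed.

Lemma pospart1B_integral :
  P.-integrable (cube R n) (EFin \o (fun x => pospart1B (peval g x))) /\
  (\int[P]_(x in cube R n) (pospart1B (peval g x))%:E =
   (2 ^- n)%:E * ((m%:R / (wnorm w + m)%:R)%:E * vol (sublevel1 g)))%E.
Proof.
have pg0 x : 0 <= pospart1B (peval g x) by rewrite /pospart1B le_max lexx.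
split.
  apply: (@bounded_cube_integrable _ 1); first exact: measurable_pospart1B_peval.
  move=> x _; rewrite ger0_norm// /pospart1B ge_max ler01 /=.
  by rewrite gerBl.
rewrite (@eq_measure_integral _ _ _ _ (mscale (2%:R ^- n)%:nng vol)); last first.
  move=> A mA AB; rewrite /cube_uniform/= /mscale/= /mrestr; congr (_ * vol _)%E.
  exact/setIidPl.
rewrite ge0_integral_mscale//; last 2 first.
- by apply: measurable_funTS; apply/measurable_EFinP; exact: measurable_pospart1B_peval.
- by move=> x _; rewrite lee_fin.
rewrite -integral_pospart1B_peval//; congr (_ * _)%E.
(* Outside the cube [g > 1], as the sublevel set lies inside it, so the integrand vanishes and the
   integral over the cube is the one over the whole space. *)
rewrite integral_mkcond; apply: eq_integral => x _.
rewrite patchE; case: ifPn => //; rewrite notin_setE => xB.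
rewrite /pospart1B max_l// subr_le0 leNgt; apply/negP => g1.
by apply: xB; apply: K_sub_B; exact: ltW.
Qed.

Lemma vol_sublevel1_fin : vol (sublevel1 g) \is a fin_num.
Proof.
rewrite ge0_fin_numE//; apply: (@le_lt_trans _ _ (vol (cube R n))).
  by apply: le_measure => //; rewrite inE//; exact: measurable_sublevel.
rewrite (_ : cube R n = [set x | forall i, [set` `[-1, 1]%R] (tnth x i)]); last first.
  by apply/seteqP; split => x /= H i; have := H i; rewrite /= in_itv.
rewrite (lebesgue_tuple_prod (A := fun=> [set` `[-1, 1]%R]))//.
by rewrite lebesgue_measure_itv/= lte_fin gtrN// -EFinB prodEFin ltry.
Qed.

(** Both numbers are [C] times the integral over the cube, of the truncation and of the positive
    part respectively, evaluated at [g]. These integrands differ by at most [cheb_err b r], and the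
    cube has mass one. *)
Lemma vol_approx_le r :
  `|vol_approx w m g b r - fine (vol (sublevel1 g))| <= vol_radius w m b r.
Proof.
have [Tint TE] := cheb_trunc_peval_integral r.
have [pint pE] := pospart1B_integral.
set C : R := (wnorm w + m)%:R / m%:R * 2 ^+ n.
have m0' : 0 < m%:R :> R by rewrite ltr0n.
have wm0 : 0 < (wnorm w + m)%:R :> R by rewrite ltr0n addn_gt0 m0 orbT.
have C0 : 0 < C by rewrite mulr_gt0 ?divr_gt0// exprn_gt0.
have -> : vol_approx w m g b r = C * \int[P]_(x in cube R n) cheb_trunc b r (peval g x).
  by rewrite /vol_approx -TE /C; congr (_ * _); ring.
have -> : fine (vol (sublevel1 g)) = C * \int[P]_(x in cube R n) pospart1B (peval g x).
  rewrite /Rintegral pE -[in RHS](fineK vol_sublevel1_fin)/= /C.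
  have : 2 ^+ n != 0 :> R by rewrite expf_neq0.
  move: (fine _) (2 ^+ n) (m%:R : R) m0' ((wnorm w + m)%:R : R) wm0 => v z p p0 q q0 z0.
  by field; rewrite z0 !gt_eqF.
rewrite -mulrBr -RintegralB// normrM (gtr0_norm C0) ler_pM2l//.
apply: le_trans (le_normr_Rintegral _ _) _ => //.
  exact: (integrableB mcube Tint pint).
rewrite -[leRHS]Rintegral_cube_cst; apply: le_Rintegral => //.
- exact: (integrable_norm (integrableB mcube Tint pint)).
- by apply: (@bounded_cube_integrable _ `|cheb_err b r|) => //.
- move=> x xB; rewrite distrC; apply: le_cheb_err => //.
  by rewrite g_ge0 g_le.
Qed.

End cube_uniform_integrals.

Theorem theorem3 (R : realType) (n m : nat) (w : 'I_n -> nat)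
    (g : mpoly.mpoly n R) (gbar : R)
    (n_ge1 : (1 <= n)%N) (m_ge1 : (1 <= m)%N) (w_gt0 : forall i, (0 < w i)%N)
    (g_ge0 : forall x : euclid R n, 0 <= peval g x)
    (g_qh : quasi_homogeneous w m g)
    (g_gt0 : forall x : euclid R n, (exists i, (tnth x i : R) != 0) -> 0 < peval g x)
    (K_sub_B : sublevel1 g `<=` cube R n)
    (gbar_max : (peval g @` cube R n) gbar /\ ubound (peval g @` cube R n) gbar)
    (gbar_gt1 : 1 < gbar) :
  [/\ forall r : nat,
        ((vol_lower w m g gbar r)%:E <= lebesgue_tuple n (sublevel1 g))%E /\
        (lebesgue_tuple n (sublevel1 g) <= (vol_upper w m g gbar r)%:E)%E,
      forall r : nat,
        vol_upper w m g gbar r - vol_lower w m g gbar r =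
        2 * (wnorm w + m)%:R / m%:R * 2 ^+ n * cheb_err gbar r,
      r%:R * (vol_upper w m g gbar r - vol_lower w m g gbar r) @[r --> \oo] -->
        2 ^+ n.+1 * (wnorm w + m)%:R * Num.sqrt (gbar - 1) / (pi * m%:R),
      forall r : nat,
        (`|(vol_approx w m g gbar r)%:E - lebesgue_tuple n (sublevel1 g)| <=
         ((wnorm w + m)%:R / m%:R * 2 ^+ n * cheb_err gbar r)%:E)%E &
      (fun r : nat => (wnorm w + m)%:R / m%:R * 2 ^+ n * cheb_err gbar r)
        =O_\oo (fun r : nat => r%:R^-1 : R)].
Proof.
have w0 : (0 < wnorm w)%N.
  by rewrite /wnorm (bigD1 (Ordinal n_ge1))//= addn_gt0 w_gt0.
have g_le x : cube R n x -> peval g x <= gbar by move=> xB; apply: gbar_max.2; exists x.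
have V_fin := vol_sublevel1_fin K_sub_B.
have bracket r := vol_approx_le g_qh m_ge1 w0 g_ge0 K_sub_B g_le gbar_gt1 r.
set C : R := (wnorm w + m)%:R / m%:R * 2 ^+ n.
have C_ge0 : 0 <= C by rewrite mulr_ge0 ?exprn_ge0// divr_ge0.
have radiusE r : vol_radius w m gbar r = C * cheb_err gbar r by [].
have widthE r : vol_upper w m g gbar r - vol_lower w m g gbar r =
    2 * C * cheb_err gbar r.
  by rewrite /vol_upper /vol_lower radiusE; ring.
split.
- move=> r; rewrite -(fineK V_fin) !lee_fin /vol_lower /vol_upper.
  by have := bracket r; rewrite ler_norml; lra.
- by move=> r; rewrite widthE /C; ring.
- under eq_fun do rewrite widthE mulrCA.
  have -> : 2 ^+ n.+1 * (wnorm w + m)%:R * Num.sqrt (gbar - 1) / (pi * m%:R) =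
      2 * C * (Num.sqrt (gbar - 1) / pi).
    by rewrite exprS invfM /C; ring.
  by apply: cvgM; [exact: cvg_cst|exact: cheb_err_cvg].
- move=> r; rewrite -(fineK V_fin) -EFinB abse_EFin lee_fin -radiusE.
  exact: bracket.
(* [3 = 1 + 2] bounds [sin t / (pi r)] by [1 / r] and [2 / r^2] by [2 / r] in [cheb_err_upper]; the
   final [+ 1] makes the constant strictly positive. *)
- apply/eqO_exP; exists (C * (gbar / 2 * 3) + 1).
    rewrite ltr_wpDl// mulr_ge0// mulr_ge0// divr_ge0// ltW//.
    exact: lt_trans gbar_gt1.
  near=> r.
  have r0 : (0 < r)%N by near: r; exact: nbhs_infty_gt.
  have R0 : 0 < r%:R :> R by rewrite ltr0n.
  have b20 : 0 <= gbar / 2 by rewrite divr_ge0// ltW// (lt_trans _ gbar_gt1).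
  have e0 := cheb_err_ge0 gbar_gt1 r.
  have rV0 : 0 <= r%:R^-1 :> R by rewrite invr_ge0.
  rewrite -/C (ger0_norm (mulr_ge0 C_ge0 e0)) (ger0_norm rV0) mulrDl mul1r.
  apply: ler_wpDr => //.
  rewrite (_ : C * _ / _ = C * (gbar / 2 * (3 * r%:R^-1))); last by ring.
  apply: ler_wpM2l => //; apply: le_trans (cheb_err_upper gbar_gt1 r0) _.
  apply: ler_wpM2l => //.
  have H1 : sin (kink_angle gbar) / (pi * r%:R) <= r%:R^-1.
    rewrite invfM mulrA ler_piMl// ler_pdivrMr ?pi_gt0// mul1r.
    by rewrite (le_trans (sin_le1 _))// (le_trans _ (@pi_ge2 R))// ler1n.
  have H2 : 2 / r%:R ^+ 2 <= 2 / r%:R :> R.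
    by rewrite ler_pM2l// lef_pV2 ?posrE ?exprn_gt0// expr2 ler_peMr ?(ltW R0)// ler1n.
  by move: H1 H2; move: (r%:R^-1) (_ / (pi * _)) (2 / _ ^+ 2) => a c d; lra.
Unshelve. all: by end_near. Qed.
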